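(* For every $p\in[0,1/2)$ and every sorting rate $R<\frac12\bigl(1-H(p)\bigr)$, the rate $R$ is achievable for the noisy sorting problem with crossover probability $p$. In other words, $C(p)\ge \frac12\bigl(1-H(p)\bigr)$.
   Context: Noisy sorting problem. Fix $p\in[0,1/2)$. Let $\theta_1,\ldots,\theta_n$ be distinct real numbers; their ordering is the permutation $\pi$ of $[n]=\{1,\ldots,n\}$ with $\theta_{\pi(1)}<\cdots<\theta_{\pi(n)}$. At time step $k=1,2,\ldots$ an agent submits a query $(U_k,V_k)=(\theta_i,\theta_j)$ for some $i\neq j$ and receives $Y_k=\mathbb{1}_{\{U_k<V_k\}}\oplus Z_k$, where $Z_1,Z_2,\ldots$ are i.i.d. $\mathrm{Bern}(p)$, independent of everything else. An adaptive querying strategy is a causal (possibly randomized) rule $(U_k,V_k)=f_k(Y^{k-1},U^{k-1},V^{k-1})$ together with a stopping time $M$ (the number of queries), which may depend on the responses; the strategy is fixed-length if $M$ is predetermined. An $(R,n)$ noisy sorting code consists of such a strategy and an estimator $\hat\Pi=\hat\pi(Y^M,U^M,V^M)$ of $\pi$, with $\mathbb{E}[M]=\frac{n\log n}{R}$ (here $\log=\log_2$); $R$ is its sorting rate. A rate $R$ is achievable if there is a sequence (indexed by $n$) of $(R,n)$ noisy sorting codes with $\lim_{n\to\infty}\max_{\pi}\mathbb{P}\{\hat\Pi\neq\pi\}=0$. The noisy sorting capacity $C(p)$ is the supremum of achievable rates. $H(p)=-p\log_2 p-(1-p)\log_2(1-p)$ is the binary entropy function. *)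

(* Defs.v *)
From HB Require Import structures.
From mathcomp Require Import all_boot all_order all_algebra all_fingroup.
From mathcomp Require Import all_classical all_reals all_analysis.
Set Implicit Arguments. Unset Strict Implicit. Unset Printing Implicit Defensive.
Import Order.TTheory GRing.Theory Num.Theory.
Local Open Scope ring_scope.

Section NoisySorting.
Variable R : realType.

Definition log2 (x : R) : R := ln x / ln 2.
Definition xlog2 (x : R) : R := if x == 0 then 0 else x * log2 x.
Definition binary_entropy (p : R) : R := - xlog2 p - xlog2 (1 - p).

Variable n : nat.

(* One interaction step: the queried pair of item indices (i, j) and the
   observed response bit Y. *)
Definition entry := ('I_n * 'I_n * bool)%type.
Definition history := seq entry.

(* An adaptive (behavioural-randomized) querying strategy with a randomized
   stopping rule and a deterministic estimator:
   - stop_prob h : probability of stopping right after history h;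
   - query_prob h i j : probability that the next query is (theta_i, theta_j)
     given history h (and not stopping);
   - estimate h : the estimate of pi when stopping after history h. *)
Record sorting_code := SortingCode {
  stop_prob : history -> R;
  query_prob : history -> 'I_n -> 'I_n -> R;
  estimate : history -> {perm 'I_n}
}.

Definition valid_code (c : sorting_code) : Prop :=
  forall h : history,
    [/\ 0 <= stop_prob c h <= 1,
        (forall i j, 0 <= query_prob c h i j),
        (forall i, query_prob c h i i = 0) &
        (stop_prob c h < 1 -> \sum_(i : 'I_n) \sum_(j : 'I_n) query_prob c h i j = 1)].

(* Probability that the response to query (theta_i, theta_j) equals y when the
   true ordering is pi (theta_{pi 0} < ... < theta_{pi (n-1)}, so the rank of
   item i is pi^-1 i): Y = 1{theta_i < theta_j} xor Z, Z ~ Bern(p). *)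
Definition response_prob (p : R) (pi : {perm 'I_n}) (i j : 'I_n) (y : bool) : R :=
  if y == (val ((pi^-1)%g i) < val ((pi^-1)%g j))%N then 1 - p else p.

Definition step_prob (p : R) (pi : {perm 'I_n}) (c : sorting_code)
    (h : history) (e : entry) : R :=
  (1 - stop_prob c h) * query_prob c h e.1.1 e.1.2 * response_prob p pi e.1.1 e.1.2 e.2.

Definition reach_prob (p : R) (pi : {perm 'I_n}) (c : sorting_code) (h : history) : R :=
  \prod_(k < size h) step_prob p pi c (take k h) (tnth (in_tuple h) k).

Definition stop_at (p : R) (pi : {perm 'I_n}) (c : sorting_code) (h : history) : R :=
  reach_prob p pi c h * stop_prob c h.

Local Open Scope ereal_scope.

Definition prob_stop (p : R) (pi : {perm 'I_n}) (c : sorting_code) : \bar R :=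
  \sum_(0 <= k <oo) (\sum_(h : k.-tuple entry) stop_at p pi c h)%R%:E.

(* E[M] (on the event M < oo; combined with prob_stop = 1 this is E[M]) *)
Definition expected_M (p : R) (pi : {perm 'I_n}) (c : sorting_code) : \bar R :=
  \sum_(0 <= k <oo) (k%:R * \sum_(h : k.-tuple entry) stop_at p pi c h)%R%:E.

Definition error_prob (p : R) (pi : {perm 'I_n}) (c : sorting_code) : \bar R :=
  \sum_(0 <= k <oo)
    (\sum_(h : k.-tuple entry) stop_at p pi c h * (estimate c h != pi)%:R)%R%:E.

End NoisySorting.

Local Open Scope ereal_scope.

Definition is_code (R : realType) (p Rt : R) (n : nat) (c : sorting_code R n) : Prop :=
  valid_code c /\
  forall pi : {perm 'I_n},
    prob_stop p pi c = 1 /\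
    expected_M p pi c = ((n%:R * log2 n%:R) / Rt)%R%:E.

Definition achievable (R : realType) (p Rt : R) : Prop :=
  exists codes : forall n : nat, sorting_code R n,
    (forall n, is_code p Rt (codes n)) /\
    ((fun n => \big[maxe/0]_(pi : {perm 'I_n}) error_prob p pi (codes n)) @ \oo --> 0)%classic.

(* Main.v *)
(* Insertion sort in which every insertion is a noisy binary search carried out by
   Bayesian updating over the possible slots of the new item (Burnashev-Zigangirov),
   stopped as soon as one slot has posterior odds at least A = n^(1+eps).  The query
   threshold is randomised next to the posterior median so that the posterior mass on
   either side is 1/2 on average.  If r denotes the inverse odds of the true slot, then
   E[r^eta] decreases at each query by a factor close to exp(-eta (1 - H(p)) ln 2) for
   small eta; as ln r has to go from ln n down to -ln A, an insertion takes about
   2 log n / (1 - H(p)) queries, and a potential multiplying the contributions of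
   the insertions bounds the probability that n insertions exceed the budget.
   By Bayes' rule a wrong stop has probability at most 1/A on average over a uniform true slot.
   A random shift (drawn once and shared by all insertions, with dummy slots on both
   sides of the list) turns this average into a bound for every ordering, so that some
   insertion fails with probability O(n/A) = O(n^(-eps)).  Randomised padding by one query makes
   the expected number of queries exact. *)

Require Import Defs.
From HB Require Import structures.
From mathcomp Require Import all_boot all_order all_algebra all_fingroup.
From mathcomp Require Import all_classical all_reals all_analysis.
From mathcomp Require Import ring lra zify.
Set Implicit Arguments. Unset Strict Implicit. Unset Printing Implicit Defensive.
Import Order.TTheory GRing.Theory Num.Theory.
Local Open Scope ring_scope.

(** * Inequalities for real powers *)

Lemma powR_le_tangent (R : realType) (y eta : R) : 0 <= y -> 0 < eta -> eta < 1 ->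
  y `^ eta <= 1 + eta * (y - 1).
Proof.
rewrite le_eqVlt => /predU1P[<-|y0] eta0 eta1.
  by rewrite powR0 ?gt_eqF//; lra.
rewrite /powR gt_eqF//; set t := ln y; set z := expR (eta * t).
have z0 : 0 < z by exact: expR_gt0.
have yE : y = z * expR ((1 - eta) * t).
  by rewrite -expRD -mulrDl addrC subrK mul1r lnK.
have oneE : 1 = z * expR (- (eta * t)) by rewrite -expRD subrr expR0.
(* Both bounds are [1 + s <= expR s]; weighting them by [eta] and [1 - eta] cancels [t] and leaves
   [z <= eta * y + (1 - eta)]. *)
have h1 : z * (1 + (1 - eta) * t) <= y.
  by rewrite [leRHS]yE ler_pM2l// expR_ge1Dx.
have h2 : z * (1 - eta * t) <= 1.
  by rewrite [leRHS]oneE ler_pM2l// expR_ge1Dx.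
have := ler_wpM2l (ltW eta0) h1.
have : (1 - eta) * (z * (1 - eta * t)) <= (1 - eta) * 1.
  by rewrite ler_wpM2l//; lra.
by move=> *; nra.
Qed.

Lemma powR_homo (R : realType) (e x y : R) : 0 <= e -> 0 <= x -> x <= y -> x `^ e <= y `^ e.
Proof.
by move=> e0 x0 xy; apply: ge0_ler_powR => //; rewrite nnegrE// (le_trans x0).
Qed.

(** * Noisy binary search by Bayesian updating *)

Section Search.
Variables (R : realType) (p : R) (M : nat) (A : R).
Hypotheses (p0 : 0 <= p) (p2 : p < 1 / 2) (A1 : 1 <= A).
Implicit Types (L : 'I_M -> R) (x m : 'I_M).

Definition total_mass L : R := \sum_j L j.
Definition below L m : R := \sum_(j : 'I_M | (j < m)%N) L j.
Definition above L m : R := \sum_(j : 'I_M | (m < j)%N) L j.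

Definition is_median L m :=
  [&& 0 < L m, below L m <= total_mass L / 2 & above L m <= total_mass L / 2].

Definition median L := [pick m | is_median L m].

(** A threshold [t] asks whether the true slot is at least [t]; [b] tells whether the median slot
    itself lies on the upper side. *)
Definition threshold L (b : bool) : nat :=
  if median L is Some m then if b then val m else (val m).+1 else 0%N.

(* Chosen so that the posterior mass above a random threshold is 1/2 on average. *)
Definition side_prob L (b : bool) : R :=
  if median L is Some m
  then (total_mass L / 2 - (if b then above L m else below L m)) / L m
  else 1 / 2.

Definition answer_prob (x t : nat) (y : bool) : R :=
  if y == (t <= x)%N then 1 - p else p.

Definition update L (t : nat) (y : bool) : 'I_M -> R :=
  fun j => L j * answer_prob j t y.

Definition others L x : R := \sum_(j | j != x) L j.

(** For nonnegative [L], the clause [0 < L j] excludes a decision when all likelihoods vanish. *)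
Definition decision L : option 'I_M :=
  [pick j | (0 < L j) && (A * others L j <= L j)].

Lemma total_mass_split L m : total_mass L = L m + below L m + above L m.
Proof.
rewrite /total_mass /below /above (bigD1 m)//= -addrA; congr (_ + _).
rewrite (bigID (fun j : 'I_M => (j < m)%N))/=; congr (_ + _); apply: eq_bigl => j.
  by rewrite -val_eqE/= neq_ltn; case: ltngtP.
by rewrite -val_eqE/= neq_ltn; case: ltngtP.
Qed.

Lemma total_mass_others L x : total_mass L = L x + others L x.
Proof. by rewrite /total_mass (bigD1 x). Qed.

Lemma side_prob_ge0 L b : 0 <= side_prob L b.
Proof.
rewrite /side_prob /median; case: pickP => [m /and3P[Lm lo hi]|_]; last by lra.
by apply: divr_ge0; [case: b; rewrite subr_ge0 | exact: ltW].
Qed.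

Lemma side_prob_sum L : side_prob L true + side_prob L false = 1.
Proof.
rewrite /side_prob /median; case: pickP => [m /and3P[Lm lo hi]|_]; last by lra.
have Lm0 : L m != 0 by rewrite gt_eqF.
by rewrite -mulrDl; apply: (canLR (mulfK Lm0)); rewrite mul1r (total_mass_split L m); lra.
Qed.

Lemma median_exists L : (forall j, 0 <= L j) -> 0 < total_mass L ->
  exists m, is_median L m.
Proof.
move=> L0 T0.
pose upto (k : nat) := \sum_(j : 'I_M | (j < k)%N) L j.
have ex : exists k, total_mass L / 2 <= upto k.
  exists M; rewrite /upto (eq_bigl predT) => [|j]; last by rewrite ltn_ord.
  by rewrite -/(total_mass L); lra.
(* The median is the last slot of the shortest prefix that carries half of the mass. *)
case: (ex_minnP ex) => -[|k] uk kmin.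
  by move: uk; rewrite /upto big_pred0//; lra.
have kM : (k < M)%N.
  rewrite ltnNge; apply/negP => Mk.
  have : total_mass L / 2 <= upto k.
    move: uk; rewrite /upto (eq_bigl (fun j : 'I_M => (j < k)%N))// => j.
    by rewrite !(leq_trans (ltn_ord j))// ltnW.
  by move/kmin; rewrite ltnn.
pose m := Ordinal kM.
have um : upto k.+1 = L m + below L m.
  rewrite /upto (bigD1 m)//=; congr (_ + _); apply: eq_bigl => j.
  by rewrite ltnS -val_eqE/= [in RHS]ltn_neqAle andbC.
have lt_um : below L m < total_mass L / 2.
  by rewrite ltNge; apply/negP => /(kmin k); rewrite ltnn.
exists m; apply/and3P; split.
- by move: uk; rewrite um; lra.
- exact: ltW.
- by have := total_mass_split L m; move: uk; rewrite um; lra.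
Qed.

Lemma decision_some L j : decision L = Some j -> 0 < L j /\ A * others L j <= L j.
Proof. by rewrite /decision; case: pickP => // ? /andP[? ?] [<-]. Qed.

(** A search still undecided after [T] queries counts as not wrong; running out of queries is
    bounded separately. *)
Fixpoint wrong_prob (T : nat) x L : R :=
  if T is T'.+1 then
    \sum_(b : bool) side_prob L b * \sum_(y : bool)
      answer_prob x (threshold L b) y *
      (let L' := update L (threshold L b) y in
       if decision L' is Some j then (j != x)%:R else wrong_prob T' x L')
  else 0.

Lemma answer_prob_ge0 x t y : 0 <= answer_prob x t y.
Proof. by rewrite /answer_prob; have := p0; have := p2; case: ifP => _; lra. Qed.

Lemma answer_prob_sum (x t : nat) : \sum_(y : bool) answer_prob x t y = 1.
Proof.
by rewrite big_bool /answer_prob; case: (t <= x)%N => /=; lra.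
Qed.

Lemma update_ge0 L t y : (forall j, 0 <= L j) -> forall j, 0 <= update L t y j.
Proof. by move=> L0 j; rewrite mulr_ge0// answer_prob_ge0. Qed.

Lemma total_mass_update L t : \sum_(y : bool) total_mass (update L t y) = total_mass L.
Proof.
rewrite exchange_big; apply: eq_bigr => j _.
by rewrite -mulr_sumr answer_prob_sum mulr1.
Qed.

Lemma wrong_prob_ge0 T x L : 0 <= wrong_prob T x L.
Proof.
elim: T L => [|T IH] L //=.
apply: sumr_ge0 => b _; rewrite mulr_ge0 ?side_prob_ge0//.
apply: sumr_ge0 => y _; rewrite mulr_ge0 ?answer_prob_ge0//.
by case: decision.
Qed.

Lemma wrong_probS T x L : wrong_prob T x L <= wrong_prob T.+1 x L.
Proof.
elim: T L => [|T IH] L; first exact: wrong_prob_ge0.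
rewrite [leRHS]/= [leLHS]/=.
apply: ler_sum => b _; rewrite ler_wpM2l ?side_prob_ge0//.
apply: ler_sum => y _; rewrite ler_wpM2l ?answer_prob_ge0//.
by case: decision.
Qed.

(* Bayes' rule: with a uniform prior, [L] is proportional to the posterior, and a decision
   in favour of a slot leaves at most a fraction [1 / A] of the posterior elsewhere. *)
Lemma wrong_prob_average T L : (forall j, 0 <= L j) ->
  \sum_x L x * wrong_prob T x L <= A^-1 * total_mass L.
Proof.
have A0 : 0 < A by have := A1; lra.
elim: T L => [|T IH] L L0.
  rewrite big1 => [|x _]; last by rewrite /= mulr0.
  by rewrite mulr_ge0 ?invr_ge0 ?(ltW A0)// sumr_ge0.
rewrite /=.
under eq_bigr => x _.
  rewrite mulr_sumr.
  under eq_bigr => b _.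
    rewrite mulrCA mulr_sumr.
    under eq_bigr => y _ do rewrite mulrA.
  over.
over.
rewrite exchange_big/=.
under eq_bigr => b _ do rewrite -mulr_sumr exchange_big/=.
have -> : A^-1 * total_mass L = \sum_b side_prob L b * (A^-1 * total_mass L).
  by rewrite -mulr_suml big_bool/= side_prob_sum mul1r.
apply: ler_sum => b _.
rewrite ler_wpM2l ?side_prob_ge0//.
rewrite -(total_mass_update L (threshold L b)) mulr_sumr; apply: ler_sum => y _.
set L' := update _ _ _.
have L'0 : forall j, 0 <= L' j by exact: update_ge0.
(* The prior weight [L x] times the probability of the response is the updated likelihood, so the
   sum has its original shape with [L']. *)
under eq_bigr => x _ do rewrite -/(L' x).
case E : (decision L') => [j|]; last exact: IH.
have [L'j hj] := decision_some E.
rewrite ler_pdivlMl// mulr_sumr (bigD1 j)//= eqxx !mulr0 add0r.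
apply: (@le_trans _ _ (L' j)); last first.
  by rewrite (total_mass_others _ j) lerDl sumr_ge0.
apply: le_trans hj; rewrite /others mulr_sumr; apply: ler_sum => x xj.
by rewrite (eq_sym j x) (negbTE xj)/= mulr1.
Qed.

Lemma decision_none L x : decision L = None -> 0 < L x -> A^-1 <= others L x / L x.
Proof.
rewrite /decision; case: pickP => // h _ Lx; have := h x.
rewrite Lx/= => /negbT; rewrite -ltNge => /ltW; have := A1 => A1' hx.
by rewrite ler_pdivlMr// ler_pdivrMl//; lra.
Qed.

(** * Drift of the potential during one search *)

Section Drift.
Variables (eta kappa : R).
Hypotheses (eta0 : 0 < eta) (eta1 : eta < 1) (kappa0 : 0 < kappa).

(** These are the odds against [x]: deciding for [x] means that they are at most [1 / A]. *)
Definition odds L x : R := others L x / L x.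

(* The shift by [kappa / A] bounds the loss when the odds overshoot the stopping
   threshold; the overshoot is unbounded if [p = 0]. *)
Definition potential L x : R := (odds L x + kappa / A) `^ eta.

(** Without its last factor, which pays for the shift in [potential], this has logarithmic
    derivative [- (1 - H(p)) ln 2] in [eta] at 0. *)
Definition drift_factor : R :=
  2 `^ (- eta) * ((1 - p) `^ (1 - eta) + p `^ (1 - eta)) * (1 + 2 * eta * kappa).

Definition same_side L x t : R :=
  \sum_(j | (j != x) && ((t <= j)%N == (t <= x)%N)) L j.
Definition other_side L x t : R :=
  \sum_(j | (j != x) && ((t <= j)%N != (t <= x)%N)) L j.

Lemma others_split L x t : others L x = same_side L x t + other_side L x t.
Proof. by rewrite /others (bigID (fun j : 'I_M => (t <= j)%N == (t <= x)%N)). Qed.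

Lemma others_update L x t (y : bool) :
  others (update L t y) x =
  if y == (t <= x)%N then (1 - p) * same_side L x t + p * other_side L x t
  else p * same_side L x t + (1 - p) * other_side L x t.
Proof.
rewrite (others_split _ _ t) /same_side /other_side.
case: ifP => yx; rewrite !mulr_sumr; congr (_ + _); apply: eq_bigr => j /andP[_];
  rewrite /update /answer_prob mulrC;
  by move: yx; case: (t <= j)%N; case: (t <= x)%N; case: y.
Qed.

Definition from L t : R := \sum_(j : 'I_M | (t <= j)%N) L j.
Definition upto L t : R := \sum_(j : 'I_M | (j < t)%N) L j.

Lemma same_sideE L x t :
  same_side L x t = (if (t <= x)%N then from L t else upto L t) - L x.
Proof.
apply/eqP; rewrite eq_sym subr_eq addrC; apply/eqP.
rewrite /same_side /from /upto; case: ifP => tx; rewrite (bigD1 x)/= ?ltnNge ?tx//;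
  by congr (_ + _); apply: eq_bigl => j; rewrite andbC ?ltnNge; case: (t <= j)%N.
Qed.

Lemma other_sideE L x t :
  other_side L x t = if (t <= x)%N then upto L t else from L t.
Proof.
rewrite /other_side /from /upto; case: ifP => tx; apply: eq_bigl => j;
  rewrite ?ltnNge; case: (eqVneq j x) => [->|_] /=; rewrite ?tx//;
  by case: (t <= j)%N.
Qed.

Lemma from_median L m : from L m = L m + above L m.
Proof.
rewrite /from (bigD1 m)//=; congr (_ + _); apply: eq_bigl => j.
by rewrite -val_eqE/= andbC ltn_neqAle eq_sym.
Qed.

Lemma upto_median L m : upto L m.+1 = L m + below L m.
Proof.
rewrite /upto (bigD1 m)//=; congr (_ + _); apply: eq_bigl => j.
by rewrite ltnS -val_eqE/= andbC -ltn_neqAle.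
Qed.

(** Averaged over [b], both sides of the threshold have mass 1/2 of the total. If [x] is not the
    median, its own side is fixed and the sum is [- L x]; if [x] is the median [m], the sum is
    [- (below L m - above L m) ^+ 2 / L m]. *)
Lemma balanced L x : (forall j, 0 <= L j) -> 0 < L x ->
  \sum_(b : bool) side_prob L b *
    (same_side L x (threshold L b) - other_side L x (threshold L b)) <= 0.
Proof.
move=> L0 Lx.
have T0 : 0 < total_mass L by rewrite (total_mass_others L x) ltr_pwDl// sumr_ge0.
have := side_prob_sum L.
rewrite big_bool/= /side_prob /threshold /median.
case: pickP => [m /and3P[Lm lo hi]|]; last first.
  by have [m hm] := median_exists L0 T0 => /(_ m); rewrite hm.
have tot := total_mass_split L m.
set a := (_ - above L m) / _; set b := (_ - below L m) / _ => ab.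
have aE : a * L m = total_mass L / 2 - above L m by rewrite divfK ?gt_eqF.
have bE : b * L m = total_mass L / 2 - below L m by rewrite divfK ?gt_eqF.
rewrite !same_sideE !other_sideE from_median upto_median.
rewrite -/(below L m) -/(above L m) -[upto L m]/(below L m) -[from L _.+1]/(above L m).
have [xm|mx|/val_inj mx] := ltngtP (val x) (val m).
- have -> : a * (below L m - L x - (L m + above L m)) +
    b * (L m + below L m - L x - above L m) =
    (a + b) * (below L m - L x - above L m) - a * L m + b * L m by ring.
  by rewrite ab aE bE; lra.
- have -> : a * (L m + above L m - L x - below L m) +
    b * (above L m - L x - (L m + below L m)) =
    (a + b) * (above L m - L x - below L m) + a * L m - b * L m by ring.
  by rewrite ab aE bE; lra.
- rewrite mx.
  have abE : a - b = (below L m - above L m) / L m.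
    by rewrite /a /b -mulrBl; congr (_ / _); ring.
  have -> : a * (L m + above L m - L m - below L m) +
    b * (L m + below L m - L m - above L m) =
    - ((a - b) * (below L m - above L m)) by ring.
  rewrite abE oppr_le0 mulrAC -expr2 divr_ge0 ?sqr_ge0//; exact: ltW.
Qed.

(** At a balanced threshold, a response of probability [c] multiplies the odds by [1 / (2 c)]. Hence
    [2 c u / w] is the natural variable for the tangent inequality at 1. *)
Lemma scaled_powR_le (c w u : R) : 0 <= c -> 0 < w -> 0 <= u ->
  c * u `^ eta <=
  2 `^ (- eta) * w `^ eta * (c `^ (1 - eta) * (1 + eta * (2 * (c * u) / w - 1))).
Proof.
have [e0 e1] := (eta0, eta1).
rewrite le_eqVlt => /predU1P[<-|c0] w0 u0.
  by rewrite !mul0r powR0 ?gt_eqF ?subr_gt0// mul0r mulr0.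
set y := 2 * (c * u) / w.
have y0 : 0 <= y by rewrite divr_ge0 ?mulr_ge0 ?(ltW c0) ?(ltW w0).
have uE : u = w * (2^-1 * (c^-1 * y)) by rewrite /y; field; rewrite !gt_eqF.
have c'0 : 0 <= c^-1 by rewrite invr_ge0 ltW. clearbody y.
rewrite [in leLHS]uE !powRM ?mulr_ge0 ?(ltW w0)//.
rewrite -!powR_inv1 ?(ltW c0)// -!powRrM !mulN1r.
have cE : c `^ (1 - eta) = c * c `^ (- eta).
  by rewrite powRD ?powRr1 ?(ltW c0)// (gt_eqF c0)/= implybT.
rewrite cE.
have -> : c * (w `^ eta * (2 `^ (- eta) * (c `^ (- eta) * y `^ eta))) =
  2 `^ (- eta) * w `^ eta * (c * c `^ (- eta) * y `^ eta) by ring.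
by rewrite !ler_wpM2l ?mulr_ge0 ?powR_ge0 ?(ltW c0)// powR_le_tangent.
Qed.

(** After the tangent inequality, the correct and the wrong response contribute the imbalance of the
    threshold with opposite signs. The correct one has the larger weight, and [balanced] gives its
    mean the favourable sign. *)
Lemma potential_drift L x : (forall j, 0 <= L j) -> 0 < L x -> decision L = None ->
  \sum_(b : bool) side_prob L b * \sum_(y : bool)
    answer_prob x (threshold L b) y * potential (update L (threshold L b) y) x
  <= drift_factor * potential L x.
Proof.
move=> L0 Lx dL.
have [pp pq A1' e0 e1] := And5 p0 p2 A1 eta0 eta1.
have k0 := kappa0.
have A0 : 0 < A by lra.
pose q := 1 - p.
have q0 : 0 < q by rewrite /q; lra.
have q1 : q <= 1 by rewrite /q; lra.
have p1 : p <= 1 by lra.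
set w := odds L x + kappa / A.
have rA : A^-1 <= odds L x by exact: decision_none.
have kA : 0 < kappa / A by rewrite divr_gt0.
have wA : A^-1 < w by rewrite /w; lra.
have w0 : 0 < w by rewrite (lt_trans _ wA)// invr_gt0.
(* Being undecided keeps [w] above [1 / A], so the shift [kappa / A] is at most [kappa * w]. *)
have Aw : (A * w)^-1 <= 1.
  by rewrite invf_le1 ?mulr_gt0// -ler_pdivrMl// mulr1 ltW.
pose d t := (same_side L x t - other_side L x t) / (L x * w).
have dE t : (q - p) * d t = 2 * ((1 - p) * same_side L x t + p * other_side L x t) / (L x * w)
    - odds L x / w.
  rewrite /odds (others_split L x t) /d /q; field.
  by rewrite !gt_eqF.
have vw : odds L x / w <= 1 by rewrite ler_pdivrMr// mul1r /w; lra.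
have kw c : 0 <= c -> c <= 1 -> 2 * (c * (kappa / A)) / w <= 2 * kappa.
  move=> c0 c1.
  have -> : 2 * (c * (kappa / A)) / w = (2 * kappa) * (c * (A * w)^-1).
    by field; rewrite !gt_eqF.
  rewrite ler_piMr//; first by lra.
  by rewrite mulr_ile1// invr_ge0 mulr_ge0// ltW.
have oup t y : 0 <= odds (update L t y) x.
  by rewrite divr_ge0 ?update_ge0 ?sumr_ge0// => j _; exact: update_ge0.
have step t : \sum_(y : bool)
    answer_prob x t y * potential (update L t y) x <=
  2 `^ (- eta) * w `^ eta *
   (q `^ (1 - eta) * (1 + eta * ((q - p) * d t + 2 * kappa)) +
    p `^ (1 - eta) * (1 + eta * (- ((q - p) * d t) + 2 * kappa))).
  have -> : \sum_(y : bool) answer_prob x t y * potential (update L t y) x =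
      q * potential (update L t (t <= x)%N) x +
      p * potential (update L t (~~ (t <= x)%N)) x.
    by rewrite big_bool /answer_prob /q; case: (t <= x)%N => //=; rewrite addrC.
  rewrite mulrDr lerD//.
    apply: le_trans (scaled_powR_le (ltW q0) w0 _) _; first by rewrite addr_ge0// ltW.
    rewrite ler_wpM2l ?mulr_ge0 ?powR_ge0// ler_wpM2l ?powR_ge0//.
    rewrite lerD2l ler_pM2l//.
    have -> : 2 * (q * (odds (update L t (t <= x)%N) x + kappa / A)) / w =
      2 * (q * odds (update L t (t <= x)%N) x) / w + 2 * (q * (kappa / A)) / w by ring.
    have -> : 2 * (q * odds (update L t (t <= x)%N) x) / w = (q - p) * d t + odds L x / w.
      rewrite dE subrK /odds others_update eqxx /update /answer_prob eqxx -/q; field.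
      by rewrite !gt_eqF.
    have := kw q (ltW q0) q1; lra.
  (* If [p = 0], a wrong response would annihilate the likelihood of [x], but its weight is 0. *)
  have [pE|pN] := eqVneq p 0.
    by rewrite pE mul0r powR0 ?mul0r ?mulr0// gt_eqF// subr_gt0.
  have pp0 : 0 < p by rewrite lt_def pN.
  apply: le_trans (scaled_powR_le pp w0 _) _; first by rewrite addr_ge0// ltW.
  rewrite ler_wpM2l ?mulr_ge0 ?powR_ge0// ler_wpM2l ?powR_ge0//.
  rewrite lerD2l ler_pM2l//.
  set o := odds (update _ _ _) x.
  have -> : 2 * (p * (o + kappa / A)) / w =
    2 * (p * o) / w + 2 * (p * (kappa / A)) / w by ring.
  have -> : 2 * (p * o) / w = - ((q - p) * d t) + odds L x / w.
    rewrite /o dE /odds others_update /update /answer_prob.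
    case: (t <= x)%N => /=; rewrite (others_split L x t); field;
    by rewrite !gt_eqF.
  have := kw p pp p1; lra.
apply: (@le_trans _ _ (\sum_b side_prob L b * (2 `^ (- eta) * w `^ eta *
   (q `^ (1 - eta) * (1 + eta * ((q - p) * d (threshold L b) + 2 * kappa)) +
    p `^ (1 - eta) * (1 + eta * (- ((q - p) * d (threshold L b)) + 2 * kappa)))))).
  by apply: ler_sum => b _; rewrite ler_wpM2l ?side_prob_ge0.
have bal : \sum_b side_prob L b * d (threshold L b) <= 0.
  under eq_bigr => b _ do rewrite mulrA.
  rewrite -mulr_suml pmulr_lle0 ?balanced//.
  by rewrite invr_gt0 mulr_gt0.
have qp : p `^ (1 - eta) <= q `^ (1 - eta).
  by apply: ge0_ler_powR; rewrite ?nnegrE /q ?(ltW q0)//; lra.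
rewrite /drift_factor /potential -/w -/q.
move: bal (side_prob_sum L); rewrite !big_bool/=.
set s1 := side_prob L true; set s2 := side_prob L false.
set d1 := d _; set d2 := d _.
set Q := q `^ _; set P := p `^ _; set W := w `^ _; set E := 2 `^ _ => bal s12.
have -> : s2 = 1 - s1 by lra.
have EW : 0 <= E * W by rewrite mulr_ge0 ?powR_ge0.
rewrite -subr_ge0.
(* The gap between the two sides is a product of nonnegative factors, the last being minus the mean
   imbalance. *)
have -> : E * (Q + P) * (1 + 2 * eta * kappa) * W -
  (s1 * (E * W * (Q * (1 + eta * ((q - p) * d1 + 2 * kappa)) +
      P * (1 + eta * (- ((q - p) * d1) + 2 * kappa)))) +
   (1 - s1) * (E * W * (Q * (1 + eta * ((q - p) * d2 + 2 * kappa)) +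
      P * (1 + eta * (- ((q - p) * d2) + 2 * kappa))))) =
  E * W * (eta * ((q - p) * ((Q - P) * - (s1 * d1 + (1 - s1) * d2)))) by ring.
rewrite !mulr_ge0 ?subr_ge0 ?powR_ge0 ?(ltW e0)//.
- by rewrite /q; lra.
- have -> : 1 - s1 = s2 by lra.
  by rewrite oppr_ge0.
Qed.
End Drift.
End Search.

(** * Laws of histories and codes of exact mean length *)

Section Chain.
Variables (R : realType) (n : nat) (p : R) (pi : {perm 'I_n}).
Variable Q : history n -> 'I_n -> 'I_n -> R.
Hypotheses (p0 : 0 <= p) (p1 : p <= 1) (Q0 : forall h i j, 0 <= Q h i j).

Definition transition (h : history n) (e : entry n) : R :=
  Q h e.1.1 e.1.2 * response_prob p pi e.1.1 e.1.2 e.2.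

(** The law of the history when queries go on forever; the stopping rule is restored in
    [padded_reach]. *)
Definition path_prob (h : history n) : R :=
  \prod_(k < size h) transition (take k h) (tnth (in_tuple h) k).

Definition path_mean (k : nat) (F : history n -> R) : R :=
  \sum_(h : k.-tuple (entry n)) path_prob h * F h.

Lemma response_prob_ge0 i j y : 0 <= response_prob p pi i j y.
Proof. by rewrite /response_prob; case: ifP => _ //; rewrite subr_ge0. Qed.

Lemma response_prob_sum i j : \sum_y response_prob p pi i j y = 1.
Proof.
by rewrite big_bool /response_prob; case: (_ < _)%N => /=; rewrite ?subrK// addrC subrK.
Qed.

Lemma transition_ge0 h e : 0 <= transition h e.
Proof. by rewrite mulr_ge0 ?response_prob_ge0. Qed.

Lemma sum_entry (F : entry n -> R) :
  \sum_e F e = \sum_i \sum_j \sum_y F (i, j, y).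
Proof. by rewrite pair_big/= pair_big/=; apply: eq_bigr => -[[i j] y]. Qed.

Lemma transition_sum h : \sum_i \sum_j Q h i j = 1 -> \sum_e transition h e = 1.
Proof.
move=> <-; rewrite sum_entry; apply: eq_bigr => i _; apply: eq_bigr => j _.
by rewrite /transition/= -mulr_sumr response_prob_sum mulr1.
Qed.

Lemma path_prob_ge0 h : 0 <= path_prob h.
Proof. by apply: prodr_ge0 => k _; exact: transition_ge0. Qed.

Lemma path_prob_nil : path_prob [::] = 1.
Proof. by rewrite /path_prob big_ord0. Qed.

Lemma path_prob_rcons h e : path_prob (rcons h e) = path_prob h * transition h e.
Proof.
pose F (s : history n) (k : nat) := transition (take k s) (nth e s k).
have pathE s : path_prob s = \prod_(k < size s) F s k.
  by apply: eq_bigr => k _; rewrite (tnth_nth e).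
rewrite !pathE size_rcons big_ord_recr /F/= nth_rcons ltnn eqxx.
rewrite -cats1 take_size_cat//; congr (_ * _); apply: eq_bigr => k _.
by rewrite nth_cat ltn_ord takel_cat// ltnW.
Qed.

Lemma sum_tuple_rcons k (F : history n -> R) :
  \sum_(h : k.+1.-tuple (entry n)) F h =
  \sum_(h : k.-tuple (entry n)) \sum_e F (rcons h e).
Proof.
pose f (he : k.-tuple (entry n) * entry n) : k.+1.-tuple (entry n) :=
  [tuple of rcons he.1 he.2].
rewrite (reindex f)/=; first by rewrite pair_big/=.
apply/onW_bij/inj_card_bij => [[h e] [h' e'] /(congr1 val)/=/eqP|].
  by rewrite eqseq_rcons => /andP[/eqP hh /eqP ->]; congr (_, _); exact: val_inj.
by rewrite card_prod !card_tuple expnSr.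
Qed.

Lemma path_mean0 F : path_mean 0 F = F [::].
Proof.
rewrite /path_mean (big_pred1 [tuple]) => [|h]; last by apply/esym/eqP; exact: tuple0.
by rewrite path_prob_nil mul1r.
Qed.

Lemma path_meanS k F :
  path_mean k.+1 F =
  path_mean k (fun h => \sum_e transition h e * F (rcons h e)).
Proof.
rewrite /path_mean (sum_tuple_rcons k (fun h => path_prob h * F h)).
apply: eq_bigr => h _; rewrite mulr_sumr; apply: eq_bigr => e _.
by rewrite path_prob_rcons mulrA.
Qed.

Lemma path_mean_le k F G :
  (forall h : history n, size h = k -> F h <= G h) -> path_mean k F <= path_mean k G.
Proof.
move=> FG; apply: ler_sum => h _; rewrite ler_wpM2l ?path_prob_ge0// FG//.
by rewrite size_tuple.
Qed.

Lemma path_meanD k F G :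
  path_mean k (fun h => F h + G h) = path_mean k F + path_mean k G.
Proof. by rewrite /path_mean -big_split; apply: eq_bigr => h _; rewrite mulrDr. Qed.

(** The index of [F] is the number of queries still to come, so it decreases along the chain. *)
Lemma supermartingale k (F : nat -> history n -> R) :
  (forall j h, \sum_e transition h e * F j (rcons h e) <= F j.+1 h) ->
  path_mean k (F 0%N) <= F k [::].
Proof.
move=> FS; suff H j : path_mean k (F j) <= F (k + j)%N [::].
  by rewrite (le_trans (H 0%N))// addn0.
elim: k j => [|k IH] j; first by rewrite path_mean0.
rewrite path_meanS addSnnS; apply: le_trans (IH _).
by apply: path_mean_le => h _; exact: FS.
Qed.

Lemma path_mean_cst k :
  (forall h, \sum_i \sum_j Q h i j = 1) -> path_mean k (fun=> 1) = 1.
Proof.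
move=> Q1; elim: k => [|k IH]; first by rewrite path_mean0.
rewrite path_meanS -[RHS]IH; apply: eq_bigr => h _; congr (_ * _).
by under eq_bigr do rewrite mulr1; exact: transition_sum.
Qed.

Lemma path_mean_take k F :
  (forall h, \sum_i \sum_j Q h i j = 1) ->
  path_mean k.+1 (fun h => F (take k h)) = path_mean k F.
Proof.
move=> Q1; rewrite path_meanS; apply: eq_bigr => h _; congr (_ * _).
under eq_bigr => e _ do rewrite -cats1 takel_cat ?size_tuple// take_oversize ?size_tuple//.
by rewrite -mulr_suml transition_sum// mul1r.
Qed.

Variables (T : R) (est : history n -> {perm 'I_n}).
(** The case [T = 0] is exempted from normalisation because with at most one item there is no pair
    to query. *)
Hypotheses (T0 : 0 <= T) (Q1 : T != 0 -> forall h, \sum_i \sum_j Q h i j = 1).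

(* Stops after [T] or [T + 1] queries (rounded down), with the probabilities that make the
   mean exactly [T]. *)
Definition padded_code : sorting_code R n :=
  let N := Num.truncn T in
  SortingCode
    (fun h => if (size h < N)%N then 0 else if size h == N then N.+1%:R - T else 1)
    Q (fun h => est (take N h)).

Local Notation N := (Num.truncn T).

(** Passing the test at length [N] has probability [1 - (N + 1 - T) = T - N], and the test at length
    [N + 1] always stops. *)
Lemma padded_reach h :
  reach_prob p pi padded_code h =
  path_prob h * (if (size h <= N)%N then 1 else if size h == N.+1 then T - N%:R else 0).
Proof.
rewrite /reach_prob.
under eq_bigr => k _.
  rewrite /step_prob -mulrA -/(transition _ _).
  over.
rewrite big_split/= mulrC; congr (_ * _).
have sz (k : 'I_(size h)) : size (take k h) = k by rewrite size_take ltn_ord.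
under eq_bigr => k _ do rewrite sz.
case: ltngtP => [hN|Nh|->].
- by rewrite big1// => k _; rewrite (ltn_trans (ltn_ord k))// subr0.
- have Nh' : (N.+1 <= size h)%N by [].
  case: eqVneq => [hN|hN].
    have kN : (N < size h)%N by rewrite hN.
    rewrite (bigD1 (Ordinal kN))//= ltnn eqxx big1 => [|k kN'].
      by rewrite mulr1 -natr1; ring.
    have kN2 : (k < N)%N.
      by rewrite ltn_neqAle -ltnS -hN ltn_ord andbT; exact: kN'.
    by rewrite kN2 subr0.
  have N1 : (N.+1 < size h)%N by rewrite ltn_neqAle eq_sym hN.
  by rewrite (bigD1 (Ordinal N1))//= ltnNge leqnSn/= gtn_eqF// subrr mul0r.
- by rewrite big1// => k _; rewrite ltn_ord subr0.
Qed.

(** As [F] sees only the first [N] entries, a possible extra query sums out and both stopping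
    lengths give the same mean. *)
Lemma padded_stop_sum k F : (forall h, F (take N h) = F h) ->
  \sum_(h : k.-tuple (entry n)) stop_at p pi padded_code h * F h =
  path_mean N F * (if k == N then N.+1%:R - T else if k == N.+1 then T - N%:R else 0).
Proof.
move=> FN; rewrite /stop_at.
under eq_bigr => h _ do rewrite padded_reach /= size_tuple.
case: ltngtP => [kN|Nk|->].
- rewrite ltn_eqF//= ?mulr0 ?big1// => [h _|]; first by rewrite mulr0 mul0r.
  by rewrite ltnW.
- case: eqVneq => [->|_]; last by rewrite mulr0 big1// => h _; rewrite mulr0 !mul0r.
  have [TN|TN] := eqVneq (T - N%:R) 0.
    by rewrite TN mulr0 big1// => h _; rewrite mulr0 !mul0r.
  have Tn0 : T != 0.
    by apply: contra_neq TN => ->; rewrite truncn0 subr0.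
  rewrite -(path_mean_take _ _ (Q1 Tn0)) mulr_suml; apply: eq_bigr => h _.
  by rewrite FN mulr1 mulrAC.
- rewrite mulr_suml; apply: eq_bigr => h _.
  by rewrite mulr1 mulrAC.
Qed.

Lemma truncn_bounds : N%:R <= T /\ T <= N.+1%:R.
Proof. by have /andP[? /ltW ?] := truncn_itv T0. Qed.

Lemma two_term_series (u : nat -> R) (a b : R) m : 0 <= a -> 0 <= b ->
  (forall k, u k = if k == m then a else if k == m.+1 then b else 0) ->
  (\sum_(0 <= k <oo) (u k)%:E = (a + b)%:E)%E.
Proof.
move=> a0 b0 uE.
have u0 k : (0 <= (u k)%:E)%E by rewrite lee_fin uE; case: ifP => // _; case: ifP.
rewrite (nneseries_split 0%N m.+2)//.
rewrite eseries0 => [|k mk _]; last first.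
  by rewrite uE !gtn_eqF// (leq_trans _ mk).
rewrite add0n adde0 sumEFin big_nat_recr//= big_nat_recr//=.
rewrite big_nat big1 => [|k km].
  by rewrite add0r !uE eqxx gtn_eqF// eqxx.
by rewrite uE !ltn_eqF// (leq_trans km).
Qed.

Lemma padded_error :
  error_prob p pi padded_code = (path_mean N (fun h => (est h != pi)%:R))%:E.
Proof.
have [TN NT] := truncn_bounds.
rewrite /error_prob /=.
pose F h : R := (est (take N h) != pi)%:R.
have F0 : 0 <= path_mean N F.
  by apply: sumr_ge0 => h _; rewrite mulr_ge0 ?path_prob_ge0// ler0n.
rewrite (@two_term_series _ (path_mean N F * (N.+1%:R - T)) (path_mean N F * (T - N%:R)) N).
- rewrite -mulrDr -natr1 (_ : _ - _ + _ = 1); last by ring.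
  rewrite mulr1; congr (_%:E); apply: eq_bigr => h _.
  by rewrite /F take_oversize ?size_tuple.
- by rewrite mulr_ge0// subr_ge0.
- by rewrite mulr_ge0// subr_ge0.
move=> k; rewrite (@padded_stop_sum k F) => [|h]; last by rewrite /F take_takel.
by case: ifP => // _; case: ifP => // _; rewrite mulr0.
Qed.

Lemma path_mean_one : path_mean N (fun=> 1) = 1.
Proof.
have [T00|Tn0] := eqVneq T 0; first by rewrite T00 truncn0 path_mean0.
exact/path_mean_cst/Q1.
Qed.

Lemma padded_stop_total k :
  \sum_(h : k.-tuple (entry n)) stop_at p pi padded_code h =
  if k == N then N.+1%:R - T else if k == N.+1 then T - N%:R else 0.
Proof.
have := @padded_stop_sum k (fun=> 1) (fun=> erefl).
rewrite path_mean_one mul1r => <-.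
by apply: eq_bigr => h _; rewrite mulr1.
Qed.

Lemma padded_prob_stop : prob_stop p pi padded_code = 1%E.
Proof.
have [TN NT] := truncn_bounds.
rewrite /prob_stop (@two_term_series _ (N.+1%:R - T) (T - N%:R) N) ?subr_ge0//.
  by rewrite -natr1 (_ : _ - _ + _ = 1 :> R)//; ring.
exact: padded_stop_total.
Qed.

Lemma padded_expected_M : expected_M p pi padded_code = T%:E.
Proof.
have [TN NT] := truncn_bounds.
rewrite /expected_M (@two_term_series _ (N%:R * (N.+1%:R - T)) (N.+1%:R * (T - N%:R)) N).
- by congr (_%:E); rewrite -natr1; ring.
- by rewrite mulr_ge0// subr_ge0.
- by rewrite mulr_ge0// subr_ge0.
move=> k.
rewrite padded_stop_total.
by case: eqVneq => [->//|_]; case: eqVneq => [->//|_]; rewrite mulr0.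
Qed.

Lemma padded_valid : (forall h i, Q h i i = 0) -> valid_code padded_code.
Proof.
have [TN NT] := truncn_bounds.
move=> Qii h; split=> //=.
- case: ifP => _; first by rewrite lexx ler01.
  case: ifP => _; last by rewrite lexx ler01.
  by rewrite subr_ge0 NT lerBlDr -natr1 addrC lerD2l.
- have [T00|Tn0] := eqVneq T 0; last by move=> _; exact: Q1.
  by rewrite T00 truncn0 ltn0; case: ifP => _; rewrite ?subr0 ltxx.
Qed.
End Chain.

(** In an increasing list the elements below [a] form a prefix, so one comparison with a list entry
    tests the number of predecessors. *)
Lemma sorted_nth_count (T : Type) (f : T -> nat) (x0 : T) (s : seq T) (a k : nat) :
  sorted (fun i j => f i < f j)%N s -> (k < size s)%N ->
  (f (nth x0 s k) < a)%N = (k < count (fun i => f i < a)%N s)%N.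
Proof.
elim: s k => [//|y s IH] k /= ys ks.
have s_sorted := path_sorted ys.
have ltT : transitive (fun i j => f i < f j)%N by move=> ? ? ?; exact: ltn_trans.
have [ya|ay] := ltnP (f y) a; first by case: k ks => [|k] ks //=; rewrite add1n ltnS IH.
rewrite add0n (_ : count _ s = 0%N).
  rewrite ltn0; apply/negbTE; rewrite -leqNgt; case: k ks => [//|k] ks /=.
  have /(all_nthP x0) := order_path_min ltT ys => /(_ k ks) yk.
  exact: leq_trans ay (ltnW yk).
apply/eqP; rewrite -leqn0 leqNgt -has_count -all_predC.
apply: sub_all (order_path_min ltT ys) => z /= yz.
by rewrite -leqNgt (leq_trans ay (ltnW yz)).
Qed.

(** * Insertion sort as a querying strategy *)

Section Insertion.
Variables (R : realType) (p A : R) (n0 : nat).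
(** With four items, an item and its three spares are distinct. The [2 n + 1] slots hold every
    shifted position. *)
Local Notation n := n0.+4.
Local Notation M := (n + n).+1.
Hypotheses (p0 : 0 <= p) (p2 : p < 1 / 2) (A1 : 1 <= A).

(* The items inserted so far in their estimated order, and the likelihoods of
   the possible slots of the next item. *)
Definition state := (seq 'I_n * ('I_M -> R))%type.

Definition flat : 'I_M -> R := fun=> 1.

Definition initial : state := ([:: ord0], flat).

Definition next_item (s : seq 'I_n) : 'I_n := inord (size s).

Definition insert_at (k : nat) (s : seq 'I_n) : seq 'I_n :=
  take k s ++ next_item s :: drop k s.

Definition spare (x : 'I_n) (k : nat) : 'I_n := inord ((x + k) %% n).

(** Threshold [t] compares the new item with the list entry of index [t - u - 1]; the bounds say
    that this entry exists. *)
Definition informative (u : 'I_n) (s : seq 'I_n) (t : nat) : bool :=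
  (u < t <= u + size s)%N.

(* The position of an item with [r] smaller predecessors is [u + r], for a random shift [u].
   Thresholds falling outside of the current list have a known answer: these are
   not queried, and the noise is simulated by choosing among two spare queries according to [z].
   The orientation of a query reveals the chosen threshold. *)
Definition query (u : 'I_n) (st : state) (b z : bool) : 'I_n * 'I_n :=
  let: (s, L) := st in
  let t := threshold L b in
  let x := next_item s in
  let: (i, j) := if informative u s t then (x, nth x s (t - u).-1)
                 else (spare x 1, spare x (if z then 2 else 3)) in
  if b then (i, j) else (j, i).

Definition chosen_side (s : seq 'I_n) (e : entry n) : bool :=
  let x := next_item s in
  if e.1.1 == x then true else if e.1.2 == x then false else e.1.1 == spare x 1.

(** The answer tells whether the slot is at least [t]. With the new item queried first the response
    has the reverse meaning, hence the xor. A simulated answer equals the known truth [t <= u]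
    exactly when spare 2 was drawn. *)
Definition answer (u : 'I_n) (st : state) (e : entry n) : bool :=
  let: (s, L) := st in
  let b := chosen_side s e in
  let t := threshold L b in
  if informative u s t then b (+) e.2
  else ((if b then e.1.2 else e.1.1) == spare (next_item s) 2) == (t <= u)%N.

Definition posterior (u : 'I_n) (st : state) (e : entry n) : 'I_M -> R :=
  update p st.2 (threshold st.2 (chosen_side st.1 e)) (answer u st e).

Definition advance (u : 'I_n) (st : state) (L' : 'I_M -> R) : state :=
  if decision A L' is Some j then (insert_at (j - u) st.1, flat) else (st.1, L').

Definition step (u : 'I_n) (st : state) (e : entry n) : state :=
  if (size st.1 < n)%N then advance u st (posterior u st e) else st.

Definition seed (h : history n) : 'I_n := if h is e :: _ then e.1.1 else ord0.

Definition run (h : history n) : state := foldl (step (seed h)) initial (behead h).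

Definition noise (z : bool) : R := if z then 1 - p else p.

(* The shift is drawn by the first query, whose response is ignored. *)
Definition strategy (h : history n) (i j : 'I_n) : R :=
  if h is [::] then (j == spare i 1)%:R / n%:R else
  let st := run h in
  if (size st.1 < n)%N then
    \sum_(b : bool) \sum_(z : bool)
      side_prob st.2 b * noise z * ((i, j) == query (seed h) st b z)%:R
  else ((i, j) == (ord0, spare ord0 1))%:R.

Definition estimator (h : history n) : {perm 'I_n} :=
  odflt 1%g [pick s : {perm 'I_n} | [seq s k | k <- enum 'I_n] == (run h).1].

(** Items enter in the order of their indices, so the list is always an arrangement of an initial
    segment. *)
Definition well_formed (s : seq 'I_n) : Prop :=
  uniq s /\ forall j : 'I_n, (j \in s) = (j < size s)%N.

Lemma spare_inj x k l : (k < 4)%N -> (l < 4)%N -> (spare x k == spare x l) = (k == l).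
Proof.
move=> k4 l4; rewrite -val_eqE/= !inordK ?ltn_pmod// eqn_modDl.
by rewrite !modn_small// (leq_trans k4, leq_trans l4).
Qed.

Lemma spare0 x : spare x 0 = x.
Proof. by apply: val_inj; rewrite /= inordK ?ltn_pmod// addn0 modn_small. Qed.

Lemma spare_neq x k : (0 < k < 4)%N -> (spare x k == x) = false.
Proof.
move=> /andP[k0 k4]; rewrite -[X in _ == X](spare0 x) spare_inj//.
by rewrite eqn0Ngt k0.
Qed.

Lemma next_itemE s : (size s < n)%N -> val (next_item s) = size s.
Proof. by move=> sn; rewrite /= inordK. Qed.

Lemma next_item_notin s : well_formed s -> (size s < n)%N -> next_item s \notin s.
Proof. by move=> [_ sE] sn; rewrite sE next_itemE// ltnn. Qed.

Lemma perm_insert_at k s : perm_eq (insert_at k s) (next_item s :: s).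
Proof. by rewrite /insert_at perm_catC/= perm_cons perm_catC cat_take_drop. Qed.

Lemma size_insert_at k s : size (insert_at k s) = (size s).+1.
Proof. by rewrite (perm_size (perm_insert_at k s)). Qed.

Lemma well_formed_insert_at k s : (size s < n)%N -> well_formed s ->
  well_formed (insert_at k s).
Proof.
move=> sn wf; have [us sE] := wf; split.
  by rewrite (perm_uniq (perm_insert_at k s))/= us next_item_notin.
move=> j; rewrite (perm_mem (perm_insert_at k s)) size_insert_at inE sE.
by rewrite -val_eqE next_itemE// ltnS [in RHS]leq_eqVlt.
Qed.

Lemma run_rcons h e : run (rcons h e) = if h is [::] then initial else step (seed h) (run h) e.
Proof. by case: h => [|e0 h] //; rewrite /run/= foldl_rcons. Qed.

(** Every search must start undecided for the drift bound to apply; here the other [2 n] slots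
    outweigh any single one. *)
Lemma decision_flat : decision A flat = None.
Proof.
rewrite /decision; case: pickP => // j /andP[_]; rewrite leNgt => /negP h; exfalso; apply: h.
apply: (@lt_le_trans _ _ (others flat j)); last first.
  by rewrite ler_peMl// sumr_ge0// => i _; exact: ler01.
rewrite /others /flat sumr_const cardC1 card_ord -[ltLHS]/(1%:R) ltr_nat.
by rewrite addSn.
Qed.

Record admissible (st : state) : Prop := Admissible {
  adm_wf : well_formed st.1;
  adm_size : (0 < size st.1 <= n)%N;
  adm_ge0 : forall j, 0 <= st.2 j;
  adm_undecided : decision A st.2 = None
}.

Lemma admissible_step u st e : admissible st -> admissible (step u st e).
Proof.
move=> adm; rewrite /step; case: ifP => // sn; case: (adm) => wf sz L0 dL.
rewrite /advance; case E : decision => [j|]; split=> //=.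
- exact: well_formed_insert_at.
- by rewrite size_insert_at.
- exact: decision_flat.
- by move=> j; exact: update_ge0.
Qed.

Lemma admissible_run h : admissible (run h).
Proof.
have init : admissible initial.
  split=> //; last exact: decision_flat.
  by split=> // j; rewrite inE -val_eqE/= ltnS leqn0.
elim/last_ind: h => [//|h e IH]; rewrite run_rcons; case: h IH => // e0 h IH.
exact: admissible_step.
Qed.

Lemma query_neq u st b z : admissible st -> (size st.1 < n)%N ->
  (query u st b z).1 != (query u st b z).2.
Proof.
case: st => s L adm /= sn; have wf := adm_wf adm.
suff h : let: (i, j) := (if informative u s (threshold L b)
   then (next_item s, nth (next_item s) s (threshold L b - u).-1)
   else (spare (next_item s) 1, spare (next_item s) (if z then 2 else 3))) in i != j.
  by move: h; case: (if _ then _ else _) => i j; case: b => //=; rewrite eq_sym.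
case: ifP => [/andP[ut ts]|_]; last by rewrite spare_inj//; case: z.
apply: contra (next_item_notin wf sn) => /eqP {1}->; rewrite mem_nth//.
by case: (threshold L b) ut ts => [|t]; rewrite ?ltn0 // ltnS => ut ts; rewrite subSn//= ltn_subLR.
Qed.

Lemma noise_ge0 z : 0 <= noise z.
Proof. by have := p0; have := p2; rewrite /noise; case: z; lra. Qed.

Lemma noise_sum : noise true + noise false = 1.
Proof. by rewrite /noise subrK. Qed.

Lemma strategy_ge0 h i j : 0 <= strategy h i j.
Proof.
case: h => [|e h] /=; first by rewrite mulr_ge0// ?invr_ge0 ler0n.
case: ifP => _; last exact: ler0n.
apply: sumr_ge0 => b _; apply: sumr_ge0 => z _.
by rewrite !mulr_ge0 ?noise_ge0 ?side_prob_ge0// ler0n.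
Qed.

Lemma strategy_diag h i : strategy h i i = 0.
Proof.
have neqF (q : 'I_n * 'I_n) : q.1 != q.2 -> (i, i) == q = false.
  by move=> q12; apply/negbTE; apply: contra q12 => /eqP <-.
case: h => [|e h] /=; first by rewrite eq_sym spare_neq// mul0r.
case: ifP => sn; last by rewrite neqF//= eq_sym spare_neq.
apply: big1 => b _; apply: big1 => z _.
by rewrite neqF ?mulr0// query_neq//; exact: admissible_run.
Qed.

Lemma sum_pair_delta (q : 'I_n * 'I_n) (F : 'I_n -> 'I_n -> R) :
  \sum_i \sum_j ((i, j) == q)%:R * F i j = F q.1 q.2.
Proof.
rewrite pair_big/= (bigD1 q)//= -surjective_pairing eqxx mul1r.
rewrite big1 ?addr0// => ij ijq.
by rewrite -surjective_pairing (negbTE ijq) mul0r.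
Qed.

Lemma strategy_sum h : \sum_i \sum_j strategy h i j = 1.
Proof.
case: h => [|e h].
  have n_neq0 : n%:R != 0 :> R by rewrite pnatr_eq0.
  have row i : \sum_j strategy [::] i j = n%:R^-1.
    rewrite /strategy -mulr_suml (bigD1 (spare i 1))//= eqxx big1 ?addr0 ?mul1r//.
    by move=> j /negbTE ->.
  by under eq_bigr do rewrite row; rewrite sumr_const card_ord -[LHS]mulr_natl divff.
rewrite /strategy; case: (size (run (e :: h)).1 < n)%N.
  under eq_bigr do rewrite exchange_big/=.
  rewrite exchange_big/=.
  have side b : \sum_i \sum_j \sum_z side_prob (run (e :: h)).2 b * noise z *
     ((i, j) == query (seed (e :: h)) (run (e :: h)) b z)%:R = side_prob (run (e :: h)).2 b.
    under eq_bigr do rewrite exchange_big/=.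
    rewrite exchange_big/=.
    transitivity (\sum_z side_prob (run (e :: h)).2 b * noise z); last first.
      by rewrite -mulr_sumr big_bool/= noise_sum mulr1.
    apply: eq_bigr => z _.
    under eq_bigr do under eq_bigr do rewrite mulrC.
    exact: (sum_pair_delta _ (fun _ _ => side_prob (run (e :: h)).2 b * noise z)).
  under eq_bigr do rewrite side.
  by rewrite big_bool/= side_prob_sum.
transitivity (\sum_(i : 'I_n) \sum_(j : 'I_n) ((i, j) == (ord0, spare ord0 1))%:R * (1 : R)); last first.
  exact: (sum_pair_delta _ (fun _ _ => 1)).
by apply: eq_bigr => i _; apply: eq_bigr => j _; rewrite mulr1.
Qed.
End Insertion.

(** * Comparison of a run with the true ordering *)

Section Analysis.
Variables (R : realType) (p A : R) (n0 : nat).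
Local Notation n := n0.+4.
Local Notation M := (n + n).+1.
Variable pi : {perm 'I_n}.
Implicit Types (s : seq 'I_n) (u : 'I_n) (h : history n).
Hypotheses (p0 : 0 <= p) (p2 : p < 1 / 2) (A1 : 1 <= A).
Local Notation run := (run p A).
Local Notation strategy := (@strategy R p A n0).
Local Notation step := (step p A).
Local Notation posterior := (posterior p).
Local Notation flat := (@flat R n0).
Local Notation initial := (initial R n0).
Local Notation transition := (transition p pi strategy).
Local Notation wrong_prob := (wrong_prob p A).

Definition rank (i : 'I_n) : nat := (pi^-1)%g i.

(** The correct insertion index of item [k] in the ordered list of the items before it. *)
Definition smaller (k : nat) : nat :=
  #|[set j : 'I_n | (j < k)%N && (rank j < rank (inord k))%N]|.

Definition slot (u : 'I_n) (k : nat) : 'I_M := inord (u + smaller k).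

Definition ordered (s : seq 'I_n) : bool := sorted (fun i j => rank i < rank j)%N s.

(* Besides a wrong decision, this excludes that the true slot is ruled out, which is
   an event of probability 0 that the code can represent when [p = 0]. *)
Definition correct_step (u : 'I_n) (st : state R n0) (e : entry n) : bool :=
  (size st.1 < n)%N ==>
  (if decision A (posterior u st e) is Some j then j == slot u (size st.1)
   else 0 < posterior u st e (slot u (size st.1))).

Definition good (h : history n) : bool :=
  (foldl (fun sg e => (step (seed h) sg.1 e, sg.2 && correct_step (seed h) sg.1 e))
     (initial, true) (behead h)).2.

Lemma val_slot u k : val (slot u k) = (u + smaller k)%N.
Proof.
rewrite /= inordK// ltnS leq_add ?(ltnW (ltn_ord u))//.
by rewrite -[leqRHS]card_ord max_card.
Qed.

Lemma rank_inj : injective rank.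
Proof. by move=> i j /val_inj/perm_inj. Qed.

Lemma count_smaller s : well_formed s -> (size s < n)%N ->
  count (fun i => rank i < rank (next_item s))%N s = smaller (size s).
Proof.
move=> [us sE] sn; rewrite -size_filter -(card_uniqP _) ?filter_uniq//.
by apply: eq_card => i; rewrite mem_filter inE sE andbC.
Qed.

Lemma smaller_le s : well_formed s -> (size s < n)%N -> (smaller (size s) <= size s)%N.
Proof. by move=> wf sn; rewrite -count_smaller// count_size. Qed.

Lemma ordered_insert_at s : well_formed s -> (size s < n)%N -> ordered s ->
  ordered (insert_at (smaller (size s)) s).
Proof.
move=> wf sn os; have cE := count_smaller wf sn; have mE := smaller_le wf sn.
have tr : transitive (fun i j : 'I_n => rank i < rank j)%N.
  by move=> ? ? ?; exact: ltn_trans.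
rewrite /insert_at; set x := next_item s in cE *; set m := smaller _ in cE mE *.
have lo : all (fun i => rank i < rank x)%N (take m s).
  apply/(all_nthP x) => i; rewrite size_takel// => im.
  by rewrite nth_take// sorted_nth_count// ?cE// (leq_trans im).
have hi : all (fun i => rank x < rank i)%N (drop m s).
  apply/(all_nthP x) => i; rewrite size_drop ltn_subRL => im.
  rewrite nth_drop ltn_neqAle; apply/andP; split; last first.
    by rewrite leqNgt sorted_nth_count// cE -leqNgt leq_addr.
  apply: contra (next_item_notin wf sn) => /eqP/val_inj/perm_inj.
  by rewrite -/x => ->; rewrite mem_nth.
move: os; rewrite /ordered -[in X in X -> _](cat_take_drop m s) !sorted_pairwise//.
rewrite !pairwise_cat/= => /and3P[lohi plo phi].
rewrite plo phi hi/= andbT allrel_consr lo/=.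
by rewrite lohi.
Qed.

Lemma threshold_informative u s t : well_formed s -> (size s < n)%N -> ordered s ->
  informative u s t ->
  (t <= slot u (size s))%N = (rank (nth (next_item s) s (t - u).-1) < rank (next_item s))%N.
Proof.
move=> wf sn os /andP[ut ts].
rewrite val_slot sorted_nth_count//; last first.
  by move: ut ts; case: t => [//|t]; rewrite ltnS => ut ts; rewrite subSn//= ltn_subLR.
rewrite count_smaller//; move: ut ts; case: t => [//|t]; rewrite ltnS => ut _.
by rewrite subSn//= ltn_subLR.
Qed.

(** The number of predecessors lies between 0 and [size s], so such a threshold cannot separate [u]
    from the true slot. *)
Lemma threshold_uninformative u s t : well_formed s -> (size s < n)%N ->
  ~~ informative u s t -> (t <= slot u (size s))%N = (t <= u)%N.
Proof.
move=> wf sn; rewrite /informative val_slot negb_and -leqNgt -ltnNge.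
have := smaller_le wf sn; move: (smaller _) => m ms.
case/orP => [tu|ust]; first by rewrite tu (leq_trans tu)// leq_addr.
rewrite [RHS]leqNgt (leq_trans _ ust) ?ltnS ?leq_addr//=.
by apply/negbTE; rewrite -ltnNge (leq_ltn_trans _ ust)// leq_add2l.
Qed.

Lemma seed_rcons h e : h != [::] -> seed (rcons h e) = seed h.
Proof. by case: h. Qed.

Lemma good_rcons h e : h != [::] ->
  good (rcons h e) = good h && correct_step (seed h) (run h) e.
Proof.
case: h => // e0 h _; rewrite /good /run /=.
rewrite foldl_rcons/=; congr (_ && correct_step _ _ _).
by elim/last_ind: h => //= h e1 IH; rewrite !foldl_rcons/= IH.
Qed.

Lemma good_invariant h : good h ->
  ordered (run h).1 /\
  ((size (run h).1 < n)%N -> 0 < (run h).2 (slot (seed h) (size (run h).1))).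
Proof.
elim/last_ind: h => [_|h e IH]; first by split=> // _; exact: ltr01.
have [->|h0] := eqVneq h [::]; first by split=> // _; exact: ltr01.
rewrite good_rcons// seed_rcons// run_rcons => /andP[/IH[os pos] ok].
have -> : (if h is [::] then initial else step (seed h) (run h) e) = step (seed h) (run h) e.
  by case: h h0 {IH os pos ok}.
move: ok; rewrite /correct_step /step.
case: ltnP => //= sn; rewrite /advance.
have [wf _ _ _] := admissible_run p0 p2 A1 h.
case: decision => [j /eqP ->|ok] /=; last by split.
split; last by move=> _; exact: ltr01.
by rewrite -[nat_of_ord (slot _ _)]/(val (slot _ _)) val_slot addKn ordered_insert_at.
Qed.

(** This reduces sorting to searching: the side and answer decoded from one query have the joint law
    of one step of the noisy binary search for the true slot. *)
Lemma transition_decode (h : history n) (G : bool -> bool -> R) :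
  h != [::] -> (size (run h).1 < n)%N -> ordered (run h).1 ->
  \sum_e transition h e * G (chosen_side (run h).1 e) (answer (seed h) (run h) e) =
  \sum_b side_prob (run h).2 b * \sum_y
    answer_prob p (slot (seed h) (size (run h).1)) (threshold (run h).2 b) y * G b y.
Proof.
have [wf _ _ _] := admissible_run p0 p2 A1 h.
case E : (run h) wf => [s L] /= wf; set u := seed h; set x := next_item s => h0 sn os.
have strat i j : strategy h i j = \sum_b \sum_z
    side_prob L b * noise p z * ((i, j) == query u (s, L) b z)%:R.
  by rewrite /strategy; case: h h0 E @u => // e h _ E u; rewrite E/= sn.
pose D b z y : entry n := (query u (s, L) b z, y).
(* The query law is unfolded into the hidden choices [b] and [z]. *)
have -> : \sum_e transition h e * G (chosen_side s e) (answer u (s, L) e) =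
    \sum_b side_prob L b * \sum_z noise p z * \sum_y
      response_prob p pi (D b z y).1.1 (D b z y).1.2 y *
      G (chosen_side s (D b z y)) (answer u (s, L) (D b z y)).
  rewrite sum_entry.
  pose T i j := \sum_y response_prob p pi i j y *
      G (chosen_side s (i, j, y)) (answer u (s, L) (i, j, y)).
  transitivity (\sum_b \sum_z side_prob L b * noise p z *
      \sum_i \sum_j ((i, j) == query u (s, L) b z)%:R * T i j).
    transitivity (\sum_i \sum_j \sum_b \sum_z side_prob L b * noise p z *
        (((i, j) == query u (s, L) b z)%:R * T i j)).
      apply: eq_bigr => i _; apply: eq_bigr => j _.
      rewrite /transition/=; under eq_bigr do rewrite -mulrA.
      rewrite -mulr_sumr -/(T i j) strat mulr_suml; apply: eq_bigr => b _.
      by rewrite mulr_suml; apply: eq_bigr => z _; rewrite mulrA.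
    under eq_bigr do rewrite exchange_big/=.
    rewrite exchange_big/=; apply: eq_bigr => b _.
    under eq_bigr do rewrite exchange_big/=.
    rewrite exchange_big/=; apply: eq_bigr => z _.
    by rewrite mulr_sumr; apply: eq_bigr => i _; rewrite mulr_sumr.
  apply: eq_bigr => b _; rewrite mulr_sumr; apply: eq_bigr => z _.
  by rewrite sum_pair_delta mulrA /T -surjective_pairing.
apply: eq_bigr => b _; congr (_ * _).
have [inf|uninf] := boolP (informative u s (threshold L b)).
  have tE := threshold_informative wf sn os inf.
  have xo : nth x s (threshold L b - u).-1 != x.
    apply: contra (next_item_notin wf sn) => /eqP oE; rewrite -/x -oE mem_nth//.
    move: inf => /andP[]; case: (threshold L b) => [//|t]; rewrite ltnS => ut ts.
    by rewrite subSn//= ltn_subLR.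
  set o := nth _ _ _ in tE xo.
  have side z y : chosen_side s (D b z y) = b.
    rewrite /chosen_side /D /query inf -/x -/o; case: (b) => /=; first by rewrite eqxx.
    by rewrite (negbTE xo) eqxx.
  have ans z y : answer u (s, L) (D b z y) = b (+) y.
    by rewrite /answer side inf.
  have resp z y : response_prob p pi (D b z y).1.1 (D b z y).1.2 y =
      answer_prob p (slot u (size s)) (threshold L b) (b (+) y).
    rewrite /response_prob /answer_prob tE /D /query inf -/x -/o /rank.
    (* Distinct ranks make [x] before [o] the exact negation of [o] before [x]. *)
    have := xo; rewrite -(inj_eq rank_inj) /rank => rxo.
    case: (b) => /=; last by [].
    by move: rxo; case: y; case: ltngtP.
  transitivity (\sum_y answer_prob p (slot u (size s)) (threshold L b) (b (+) y) * G b (b (+) y)).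
    under eq_bigr => z _ do under eq_bigr => y _ do rewrite side ans resp.
    by rewrite -mulr_suml big_bool/= noise_sum mul1r.
  by rewrite !big_bool; case: (b) => //=; rewrite addrC.
have tE := threshold_uninformative wf sn uninf.
have side z y : chosen_side s (D b z y) = b.
  rewrite /chosen_side /D /query (negbTE uninf) -/x.
  by case: (b) => /=; rewrite !spare_neq ?spare_inj//; case: z.
have ans z y : answer u (s, L) (D b z y) = (z == (threshold L b <= u)%N).
  rewrite /answer side (negbTE uninf) /D /query (negbTE uninf) -/x; congr (_ == _).
  by case: (b) => /=; rewrite spare_inj//; case: z.
(* The response to a spare query is ignored and sums out; [z] plays the part of the channel
   noise. *)
transitivity (\sum_z noise p z * G b (z == (threshold L b <= u)%N)).
  apply: eq_bigr => z _; congr (_ * _).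
  under eq_bigr do rewrite side ans.
  by rewrite -mulr_suml response_prob_sum mul1r.
rewrite !big_bool /answer_prob /noise tE.
by case: (threshold L b <= u)%N => //=; rewrite addrC.
Qed.

(** A list of all items that increases in rank is unique, and it enumerates the values of [pi]. *)
Lemma estimator_correct h : good h -> size (run h).1 = n -> estimator p A h = pi.
Proof.
move=> /good_invariant[os _] sn; have [[us sE] _ _ _] := admissible_run p0 p2 A1 h.
have tr : transitive (fun i j : 'I_n => rank i < rank j)%N.
  by move=> ? ? ?; exact: ltn_trans.
have runE : (run h).1 = [seq pi k | k <- enum 'I_n].
  apply: (irr_sorted_eq tr) => //; first by move=> i; exact: ltnn.
    rewrite sorted_map (eq_sorted (e' := relpre val ltn)) => [|i j]; last first.
      by rewrite /= /rank !permK.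
    by rewrite -sorted_map val_enum_ord iota_ltn_sorted.
  move=> i; rewrite sE sn ltn_ord; apply/esym/mapP.
  by exists ((pi^-1)%g i); rewrite ?mem_enum// permKV.
rewrite /estimator runE; case: pickP => [s /eqP/eq_in_map spi|/(_ pi)]; last by rewrite eqxx.
by apply/permP => k /=; rewrite spi// mem_enum.
Qed.
End Analysis.

(** * Probability of a wrong insertion *)

Section ErrorBound.
Variables (R : realType) (p A : R) (n0 : nat).
Local Notation n := n0.+4.
Local Notation M := (n + n).+1.
Variable pi : {perm 'I_n}.
Implicit Types (s : seq 'I_n) (u : 'I_n) (h : history n).
Hypotheses (p0 : 0 <= p) (p2 : p < 1 / 2) (A1 : 1 <= A).
Local Notation run := (run p A).
Local Notation strategy := (@strategy R p A n0).
Local Notation posterior := (posterior p).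
Local Notation flat := (@flat R n0).
Local Notation initial := (initial R n0).
Local Notation transition := (transition p pi strategy).
Local Notation wrong_prob := (wrong_prob p A).
Local Notation slot := (slot pi).
Local Notation good := (good p A pi).

Definition future_wrong (T : nat) u (m : nat) : R :=
  \sum_(m <= k < n) wrong_prob T (slot u k) flat.

(** A union bound over the current and all later insertions, capped at 1, the value charged to a run
    that is already wrong. *)
Definition failure (T : nat) u (st : state R n0) : R :=
  if (size st.1 < n)%N then
    Num.min 1 (wrong_prob T (slot u (size st.1)) st.2 + future_wrong T u (size st.1).+1)
  else 0.

(** At the empty history the shift is still to be drawn: this takes one of the [T] queries and
    averages over [u]. *)
Definition failure_bound (T : nat) h : R :=
  if h is [::] then (\sum_u failure T.-1 u initial) / n%:R
  else if good h then failure T (seed h) (run h) else 1.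

Lemma future_wrong_ge0 T u m : 0 <= future_wrong T u m.
Proof. by apply: sumr_ge0 => k _; exact: wrong_prob_ge0. Qed.

Lemma future_wrongS T u m : future_wrong T u m <= future_wrong T.+1 u m.
Proof. by apply: ler_sum => k _; exact: wrong_probS. Qed.

Lemma failure_ge0 T u st : 0 <= failure T u st.
Proof.
rewrite /failure; case: ifP => // _.
by rewrite le_min ler01 addr_ge0 ?wrong_prob_ge0// future_wrong_ge0.
Qed.

Lemma failure_le1 T u st : failure T u st <= 1.
Proof. by rewrite /failure; case: ifP => // _; rewrite ge_min lexx. Qed.

Lemma failure_bound_le1 T h : h != [::] -> failure_bound T h <= 1.
Proof. by case: h => //= e h _; case: ifP => // _; exact: failure_le1. Qed.

Lemma strategy_transition_sum h : \sum_e transition h e = 1.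
Proof. by apply: transition_sum; exact: strategy_sum. Qed.

Lemma transition_nonneg h e : 0 <= transition h e.
Proof. by apply: transition_ge0 => //; [have := p2; lra | move=> *; exact: strategy_ge0]. Qed.

Lemma first_transition (F : 'I_n -> R) :
  \sum_e transition [::] e * F e.1.1 = (\sum_u F u) / n%:R.
Proof.
rewrite sum_entry mulr_suml; apply: eq_bigr => i _.
have rowE j : \sum_y transition [::] (i, j, y) * F i = (j == spare i 1)%:R * (F i / n%:R).
  rewrite -mulr_suml /transition/= -mulr_sumr response_prob_sum mulr1.
  by rewrite -mulrA [_^-1 * _]mulrC.
under eq_bigr do rewrite rowE.
by rewrite -mulr_suml (bigD1 (spare i 1))//= eqxx big1 ?addr0 ?mul1r// => j /negbTE ->.
Qed.

Lemma seed_run_rcons h e : h != [::] ->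
  seed (rcons h e) = seed h /\ run (rcons h e) = step p A (seed h) (run h) e.
Proof. by rewrite run_rcons; case: h. Qed.

Lemma failure_bound_step j h :
  \sum_e transition h e * failure_bound j (rcons h e) <= failure_bound j.+1 h.
Proof.
have [->|h0] := eqVneq h [::].
  by rewrite [leRHS]/=; have /= <- := first_transition (fun u => failure j u initial).
have le1 : \sum_e transition h e * failure_bound j (rcons h e) <= 1.
  rewrite -[leRHS](strategy_transition_sum h); apply: ler_sum => e _.
  rewrite ler_piMr ?transition_nonneg// failure_bound_le1//.
  by case: (h).
have boundE T h' : h' != [::] -> failure_bound T h' =
    if good h' then failure T (seed h') (run h') else 1 by case: h'.
have rconsN e : rcons h e != [::] by case: (h).
rewrite [leRHS]boundE//; case: ifPn => // gh.
have [sn os pos] : [/\ (size (run h).1 <= n)%N, ordered pi (run h).1 &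
    ((size (run h).1 < n)%N -> 0 < (run h).2 (slot (seed h) (size (run h).1)))].
  have [_ /andP[_ sz] _ _] := admissible_run p0 p2 A1 h.
  by have [] := good_invariant p0 p2 A1 gh.
rewrite /failure; case: ltnP => sz; last first.
  rewrite big1// => e _; have [sE rE] := seed_run_rcons e h0.
  rewrite boundE// good_rcons// gh sE rE /correct_step /step ltnNge sz/=.
  by rewrite /failure ltnNge sz mulr0.
rewrite le_min le1/=.
set u := seed h in pos *; set x := slot u _ in pos *; set L := (run h).2 in pos *.
set tail := future_wrong _ _ _.
(* The indicator charges 1 to a response that rules out the true slot. Such a response has
   probability 0, so the charge vanishes in the mean. *)
pose G b y : R := (answer_prob p x (threshold L b) y == 0)%:R +
  (let L' := update p L (threshold L b) y in
   if decision A L' is Some j' then (j' != x)%:R else wrong_prob j x L').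
have key : forall e, failure_bound j (rcons h e) <=
    G (chosen_side (run h).1 e) (answer u (run h) e) + tail.
  move=> e; have [sE rE] := seed_run_rcons e h0.
  have tail0 : 0 <= tail by exact: future_wrong_ge0.
  have tailS := future_wrongS j u (size (run h).1).+1.
  rewrite boundE// good_rcons// gh sE rE /correct_step /step sz/= /advance.
  rewrite -/u -/x /G -/(posterior u (run h) e).
  case E : decision => [j'|].
    have [j'x|j'x] /= := eqVneq j' x; last first.
      by rewrite -[leLHS]addr0 lerD// -[leLHS]add0r lerD// ler0n.
    rewrite /failure size_insert_at/=; case: ltnP => sz'; last by rewrite !addr_ge0 ?ler0n.
    rewrite addr0 ge_min; apply/orP; right.
    rewrite -[leLHS]add0r lerD ?ler0n//; apply: le_trans tailS.
    (* After a correct insertion the next search starts flat, which is the first term of the union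
       bound. *)
    by rewrite /future_wrong [leRHS]big_ltn.
  case: ifPn => [_|].
    rewrite /failure/= sz ge_min; apply/orP; right.
    by rewrite lerD// -[leLHS]add0r lerD ?ler0n.
  rewrite /posterior /update -/x -leNgt pmulr_rle0 ?pos// => ans0.
  rewrite (_ : _ == 0 = true); last by rewrite eq_le ans0 answer_prob_ge0.
  by rewrite -[leLHS]addr0 lerD// -[leLHS]addr0 lerD// wrong_prob_ge0.
apply: (@le_trans _ _ (\sum_e transition h e *
    (G (chosen_side (run h).1 e) (answer u (run h) e) + tail))).
  by apply: ler_sum => e _; rewrite ler_wpM2l ?transition_nonneg.
have -> : \sum_e transition h e * (G (chosen_side (run h).1 e) (answer u (run h) e) + tail) =
    \sum_e transition h e * G (chosen_side (run h).1 e) (answer u (run h) e) + tail.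
  transitivity (\sum_e (transition h e * G (chosen_side (run h).1 e) (answer u (run h) e) +
      transition h e * tail)); first by apply: eq_bigr => e _; rewrite mulrDr.
  by rewrite big_split -mulr_suml strategy_transition_sum mul1r.
rewrite lerD2r.
rewrite (transition_decode p0 p2 A1 G h0 sz os) -/u -/x -/L /=.
rewrite le_eqVlt; apply/orP; left; apply/eqP.
apply: eq_bigr => b _; congr (_ * _); apply: eq_bigr => y _.
rewrite mulrDr; set q := answer_prob _ _ _ _.
by rewrite (_ : q * (q == 0)%:R = 0) ?add0r//; case: eqVneq => [->|_]; rewrite ?mul0r ?mulr0.
Qed.

(** For each insertion, the [n] shifts give distinct slots, so the sum over [u] is at most the sum
    over all slots, which Bayes' rule bounds by [M / A]. There are fewer than [n] insertions, and
    [M <= 3 n]. *)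
Lemma failure_bound_initial T : failure_bound T [::] <= 3 * n%:R / A.
Proof.
have A0 : 0 < A by have := A1; lra.
rewrite /=; set N := T.-1.
have n_gt0 : 0 < n%:R :> R by rewrite ltr0n.
have slot_sum k : \sum_u wrong_prob N (slot u k) flat <= A^-1 * M%:R.
  have := wrong_prob_average p0 p2 A1 N (L := flat) (fun=> ler01).
  have -> : total_mass flat = M%:R by rewrite /total_mass sumr_const card_ord.
  rewrite (eq_bigr (fun x => wrong_prob N x flat)) => [avg|x _]; last by rewrite mul1r.
  apply: le_trans avg.
  have inj : injective (slot^~ k).
    by move=> u v /(congr1 val); rewrite !val_slot => /addIn/val_inj.
  have -> : \sum_u wrong_prob N (slot u k) flat =
      \sum_(x in [set slot u k | u : 'I_n]) wrong_prob N x flat.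
    by rewrite big_imset/=; [exact: eq_bigl | exact: in2W].
  rewrite [leRHS](bigID (mem [set slot u k | u : 'I_n]))/=.
  by rewrite lerDl sumr_ge0// => i _; exact: wrong_prob_ge0.
rewrite ler_pdivrMr//.
apply: (@le_trans _ _ (\sum_u future_wrong N u 1)).
  apply: ler_sum => u _; rewrite /failure/= ge_min; apply/orP; right.
  by rewrite /future_wrong [leRHS]big_ltn.
rewrite exchange_big/=.
apply: (@le_trans _ _ (\sum_(1 <= k < n) A^-1 * M%:R)); first exact: ler_sum.
rewrite sumr_const_nat -[leLHS]mulr_natl [leRHS]mulrC.
apply: ler_pM => //; first by rewrite mulr_ge0// invr_ge0 ltW.
- by rewrite ler_nat leq_subr.
- rewrite mulrC ler_pM2r ?invr_gt0// -natrM ler_nat.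
  by lia.
Qed.

(** * Probability of exceeding the query budget *)

Section Time.
Variables (eta kappa c : R).
Hypotheses (eta0 : 0 < eta) (eta1 : eta < 1) (kappa0 : 0 < kappa) (kappa1 : kappa <= 1).
(* A fresh search has potential at most [M `^ eta]; one factor [c] pays for the
   jump from the end of a search to the start of the next one. *)
Hypothesis cE : c = (M%:R * (A / kappa)) `^ eta.
Local Notation potential := (potential A eta kappa).
Local Notation rho := (drift_factor p eta kappa).

(** On a run that is correct so far but unfinished this is at least 1, so its mean bounds the
    probability of such a run. *)
Definition remaining_time h : R :=
  if good h && (size (run h).1 < n)%N then
    c ^+ (n - size (run h).1) * potential (run h).2 (slot (seed h) (size (run h).1))
  else 0.

Definition time_bound (T : nat) h : R :=
  if h is [::] then rho ^+ T.-1 * c ^+ n else rho ^+ T * remaining_time h.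

Lemma rho_ge0 : 0 <= rho.
Proof.
by rewrite /drift_factor !mulr_ge0 ?addr_ge0 ?powR_ge0// !mulr_ge0// ltW ?eta0 ?kappa0.
Qed.

Lemma c_gt0 : 0 < c.
Proof. by rewrite cE powR_gt0// mulr_gt0 ?ltr0n// divr_gt0//; have := A1; lra. Qed.

Lemma c_ge_powR : M%:R `^ eta <= c.
Proof.
have Ak : 1 <= A / kappa by rewrite ler_pdivlMr// mul1r (le_trans kappa1).
rewrite cE; apply: powR_homo; rewrite ?ler0n ?(ltW eta0)//.
by rewrite ler_peMr.
Qed.

Lemma c_potential (L : 'I_M -> R) x : (forall j, 0 <= L j) -> (M%:R : R) `^ eta <= c * potential L x.
Proof.
have A0 : 0 < A by have := A1; lra.
have [k0 e0] := (kappa0, eta0).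
move=> L0; have odds0 : 0 <= odds L x by rewrite divr_ge0// sumr_ge0.
apply: (@le_trans _ _ (c * (kappa / A) `^ eta)).
  have kA0 : 0 <= kappa / A by exact: divr_ge0 (ltW k0) (ltW A0).
  have Ak0 : 0 <= M%:R * (A / kappa) by rewrite mulr_ge0// divr_ge0 ?ltW.
  have -> : M%:R = M%:R * (A / kappa) * (kappa / A) by field; rewrite !gt_eqF.
  by rewrite (powRM _ Ak0 kA0) -cE.
rewrite ler_wpM2l ?(ltW c_gt0)//; apply: powR_homo; first exact: ltW.
  exact: divr_ge0 (ltW k0) (ltW A0).
by rewrite lerDr.
Qed.

Lemma potential_flat (x : 'I_M) : potential flat x <= M%:R `^ eta.
Proof.
have [k0 e0 A1'] := And3 kappa0 eta0 A1.
have A0 : 0 < A by lra.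
have kA : kappa / A <= 1 by rewrite ler_pdivrMr// mul1r (le_trans kappa1).
have kA0 : 0 <= kappa / A by exact: divr_ge0 (ltW k0) (ltW A0).
have oE : odds flat x = (n + n)%:R.
  by rewrite /odds /others /flat divr1 sumr_const cardC1 card_ord.
have le_M : (n + n)%:R + kappa / A <= M%:R by rewrite -natr1 lerD2l.
rewrite -[leLHS]/((odds flat x + kappa / A) `^ eta) oE.
have nn0 : 0 <= (n + n)%:R + kappa / A by rewrite addr_ge0 ?ler0n.
exact: powR_homo (ltW e0) nn0 le_M.
Qed.

(** Within a search the drift supplies the factor [rho]; at a correct decision one factor [c] is
    released and absorbs the jump to a flat state. *)
Lemma time_bound_step j h :
  \sum_e transition h e * time_bound j (rcons h e) <= time_bound j.+1 h.
Proof.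
have c0 := c_gt0.
have boundE T h' : h' != [::] -> time_bound T h' = rho ^+ T * remaining_time h'.
  by case: h'.
have rconsN e : rcons h e != [::] by case: (h).
have [h0|h0] := eqVneq h [::].
  rewrite h0 [leRHS]/= -[leRHS]mul1r -(strategy_transition_sum [::]) mulr_suml.
  apply: ler_sum => e _; rewrite ler_wpM2l ?transition_nonneg//=.
  rewrite ler_wpM2l ?exprn_ge0 ?rho_ge0//.
  rewrite /remaining_time/= subn1 exprSr ler_pM2l ?exprn_gt0//.
  apply: le_trans (potential_flat _) _.
  exact: c_ge_powR.
rewrite [leRHS]boundE//.
under eq_bigr do rewrite boundE// mulrCA.
rewrite -mulr_sumr exprSr -mulrA ler_wpM2l ?exprn_ge0 ?rho_ge0//.
rewrite [in leRHS]/remaining_time.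
have [/andP[gh sz]|bad] := ifPn; last first.
  rewrite mulr0 big1// => e _; have [sE rE] := seed_run_rcons e h0.
  rewrite /remaining_time good_rcons// rE /step.
  move: bad; rewrite negb_and => /orP[/negbTE->|/negbTE ns]; first by rewrite mulr0.
  by rewrite ns ns andbF mulr0.
have [os pos] := good_invariant p0 p2 A1 gh.
have [wf ssz L0 dL] := admissible_run p0 p2 A1 h.
set u := seed h in pos *; set x := slot u _ in pos *; set L := (run h).2 in pos L0 dL *.
pose m := (n - size (run h).1)%N.
have key e : remaining_time (rcons h e) <= c ^+ m *
    potential (update p L (threshold L (chosen_side (run h).1 e)) (answer u (run h) e)) x.
  have [sE rE] := seed_run_rcons e h0.
  have L'0 : forall i, 0 <= posterior u (run h) e i by move=> i; exact: update_ge0.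
  rewrite -/(posterior u (run h) e).
  have rhs0 : 0 <= c ^+ m * potential (posterior u (run h) e) x.
    by rewrite mulr_ge0 ?exprn_ge0 ?powR_ge0// ltW.
  rewrite /remaining_time sE rE good_rcons// gh /correct_step /step sz/= /advance -/u -/x.
  case E : decision => [j'|] /=; last first.
    by case: ifPn => // /andP[_ sz'].
  case: ifPn => // /andP[_]; rewrite size_insert_at => sz'.
  have -> : m = (n - (size (run h).1).+1).+1 by rewrite /m subnS prednK// subn_gt0.
  rewrite exprSr -mulrA ler_pM2l ?exprn_gt0//.
  exact: le_trans (potential_flat _) (c_potential _ _).
apply: (@le_trans _ _ (\sum_e transition h e * (c ^+ m *
    potential (update p L (threshold L (chosen_side (run h).1 e)) (answer u (run h) e)) x))).
  by apply: ler_sum => e _; rewrite ler_wpM2l ?transition_nonneg.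
rewrite (transition_decode p0 p2 A1
  (fun b y => c ^+ m * potential (update p L (threshold L b) y) x) h0 sz os) -/u -/x -/L.
have drift := potential_drift p0 p2 A1 eta0 eta1 kappa0 L0 (pos sz) dL.
rewrite mulrCA; apply: le_trans (ler_wpM2l _ drift); last by rewrite exprn_ge0 ?ltW.
rewrite mulr_sumr le_eqVlt; apply/orP; left; apply/eqP.
apply: eq_bigr => b _; rewrite [RHS]mulrCA; congr (_ * _).
by rewrite mulr_sumr; apply: eq_bigr => y _; rewrite mulrCA.
Qed.

(** A wrong estimate comes from a wrong step or from an unfinished run, and in either case one of
    the two bounds is at least 1. The first of the [N + 1] queries only draws the shift. *)
Lemma sorting_error N :
  path_mean p pi strategy N.+1 (fun h => (estimator p A h != pi)%:R) <=
  3 * n%:R / A + rho ^+ N * c ^+ n.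
Proof.
have p1 : p <= 1 by have := p2; lra.
have S0 h i j : 0 <= strategy h i j by exact: strategy_ge0.
apply: (@le_trans _ _ (path_mean p pi strategy N.+1
    (fun h => failure_bound 0 h + time_bound 0 h))).
  apply: path_mean_le => // h hN.
  have [h0 bE tE] : [/\ h != [::], failure_bound 0 h = (if good h then failure 0 (seed h) (run h) else 1)
      & time_bound 0 h = remaining_time h].
    by case: h hN => //= e h _; rewrite expr0 mul1r.
  have [_ /andP[_ sz] L0 _] := admissible_run p0 p2 A1 h.
  rewrite bE tE /remaining_time; case: ifP => gh /=; last by rewrite addr0 lern1 leq_b1.
  move: sz; rewrite leq_eqVlt => /predU1P[sz|sz].
    by rewrite (estimator_correct p0 p2 A1 gh sz) eqxx sz ltnn addr0 failure_ge0.
  rewrite sz -[leLHS]add0r lerD ?failure_ge0//.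
  apply: (@le_trans _ _ 1); first by rewrite lern1 leq_b1.
  have M1 : 1 <= M%:R `^ eta :> R.
    have M1 : 1 <= M%:R :> R by rewrite ler1n.
    by have := powR_homo (ltW eta0) ler01 M1; rewrite powR1.
  apply: le_trans (le_trans M1 (c_potential (slot (seed h) (size (run h).1)) L0)) _.
  rewrite ler_wpM2r ?powR_ge0// -[leLHS]expr1 ler_weXn2l ?subn_gt0//.
  exact: le_trans M1 c_ge_powR.
rewrite path_meanD lerD//.
  apply: le_trans (failure_bound_initial N.+1).
  by apply: supermartingale => //; exact: failure_bound_step.
rewrite -[leRHS]/(time_bound N.+1 [::]).
by apply: supermartingale => //; exact: time_bound_step.
Qed.
End Time.
End ErrorBound.

(** * The drift factor for small exponents *)

Lemma expR_le_quadratic (R : realType) (y : R) : 0 <= y -> y <= 1 / 2 ->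
  expR y <= 1 + y + 2 * y ^+ 2.
Proof.
move=> y0 y1.
have e0 : 0 < expR y by exact: expR_gt0.
have le1 : expR y * (1 - y) <= 1.
  have oneE : 1 = expR y * expR (- y) by rewrite -expRD subrr expR0.
  by rewrite [leRHS]oneE ler_pM2l//; exact: expR_ge1Dx.
(* The product is [1 + y ^+ 2 * (1 - 2 * y)]. *)
have : 1 <= (1 + y + 2 * y ^+ 2) * (1 - y).
  have y2 : 0 <= y ^+ 2 * (1 - 2 * y) by rewrite mulr_ge0 ?sqr_ge0//; lra.
  by lra.
move=> h; have : expR y * (1 - y) <= (1 + y + 2 * y ^+ 2) * (1 - y) by lra.
by rewrite ler_pM2r//; lra.
Qed.

Lemma powR_sub1_le (R : realType) (c eta : R) : 0 <= c -> c <= 1 -> 0 < eta -> eta < 1 ->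
  - (eta * ln c) <= 1 / 2 ->
  c `^ (1 - eta) <= c - eta * (c * ln c) + 2 * eta ^+ 2 * (c * ln c ^+ 2).
Proof.
rewrite le_eqVlt => /predU1P[<-|c0] c1 eta0 eta1 h.
  by rewrite powR0 ?gt_eqF ?subr_gt0// !mul0r !mulr0 subr0 addr0.
have ln_c : ln c <= 0 by rewrite ln_le0.
rewrite powRD ?powRr1 ?(ltW c0)//; last by rewrite (gt_eqF c0) implybT.
rewrite /powR gt_eqF// mulNr.
have := expR_le_quadratic _ h; rewrite oppr_ge0 mulr_ge0_le0 ?(ltW eta0)// => /(_ isT).
move=> /(ler_wpM2l (ltW c0))/le_trans; apply.
by rewrite le_eqVlt; apply/orP; left; apply/eqP; ring.
Qed.

(** To first order the logarithm of the factor is [- eta * (g + D)], where [g] is the slack in the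
    hypothesis. The second-order term and the shift each use at most half of [g]. *)
Lemma drift_factor_le (R : realType) (p D : R) : 0 <= p -> p < 1 / 2 ->
  D < ln 2 + p * ln p + (1 - p) * ln (1 - p) ->
  exists eta kappa : R, [/\ 0 < eta < 1, 0 < kappa <= 1 &
    drift_factor p eta kappa <= expR (- (eta * D))].
Proof.
move=> p0 p2 hD; pose q := 1 - p.
pose g := ln 2 + p * ln p + q * ln q - D.
have g0 : 0 < g by rewrite /g /q; lra.
pose K := q * ln q ^+ 2 + p * ln p ^+ 2.
have q0 : 0 <= q by rewrite /q; lra.
have q1 : q <= 1 by rewrite /q; lra.
have p1 : p <= 1 by lra.
have K0 : 0 <= K by rewrite addr_ge0// mulr_ge0 ?sqr_ge0.
have lnp : ln p <= 0 by rewrite ln_le0.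
have lnq : ln q <= 0 by rewrite ln_le0.
(* With [eta = B^-1], the summands of [B] ensure in turn [eta < 1], [eta * K <= g / 4], and the
   condition of [powR_sub1_le] for [p] and for [q]. *)
pose B := 2 + 4 * K / g - 2 * ln p - 2 * ln q.
have Kg : 0 <= 4 * K / g by rewrite divr_ge0 ?mulr_ge0 ?(ltW g0).
have B2 : 2 <= B by rewrite /B; lra.
have B0 : 0 < B by lra.
pose eta := B^-1; pose kappa := Num.min 1 (g / 4).
have eta0 : 0 < eta by rewrite invr_gt0.
have etaB : eta * B = 1 by rewrite mulVf// gt_eqF.
have eta1 : eta < 1 by rewrite invf_lt1//; lra.
have k0 : 0 < kappa by rewrite lt_min ltr01 divr_gt0.
have k1 : kappa <= 1 by rewrite ge_min lexx.
have kg : kappa <= g / 4 by rewrite ge_min lexx orbT.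
have etaE : eta * (2 - 2 * ln p - 2 * ln q) + eta * (4 * K / g) = 1.
  by rewrite -[RHS]etaB /B; ring.
have ep0 : 0 <= - (eta * ln p) by rewrite oppr_ge0 mulr_ge0_le0// ltW.
have eq0 : 0 <= - (eta * ln q) by rewrite oppr_ge0 mulr_ge0_le0// ltW.
have eKg : 0 <= eta * (4 * K / g) by rewrite mulr_ge0// ltW.
have etaK : eta * K <= g / 4.
  have : eta * (4 * K / g) <= 1 by lra.
  have -> : eta * (4 * K / g) = (eta * K) * (4 / g) by ring.
  rewrite -ler_pdivlMr ?divr_gt0// mul1r invf_div.
  by [].
have hp := @powR_sub1_le R p eta p0 p1 eta0 eta1.
have hq := @powR_sub1_le R q eta q0 q1 eta0 eta1.
have sum_le : q `^ (1 - eta) + p `^ (1 - eta) <=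
    expR (- (eta * (q * ln q + p * ln p)) + 2 * eta * (eta * K)).
  apply: le_trans (expR_ge1Dx _).
  have {}hp : p `^ (1 - eta) <= p - eta * (p * ln p) + 2 * eta ^+ 2 * (p * ln p ^+ 2).
    by apply: hp; lra.
  have {}hq : q `^ (1 - eta) <= q - eta * (q * ln q) + 2 * eta ^+ 2 * (q * ln q ^+ 2).
    by apply: hq; lra.
  apply: le_trans (lerD hq hp) _.
  rewrite le_eqVlt; apply/orP; left; apply/eqP.
  by rewrite /K /q; ring.
exists eta, kappa; split; [by rewrite eta0|by rewrite k0|].
rewrite /drift_factor -/q.
have two : 2 `^ (- eta) = expR (- eta * ln 2) :> R by rewrite /powR gt_eqF.
have kexp : 1 + 2 * eta * kappa <= expR (2 * eta * kappa) by exact: expR_ge1Dx.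
apply: (@le_trans _ _ (expR (- eta * ln 2) *
   expR (- (eta * (q * ln q + p * ln p)) + 2 * eta * (eta * K)) * expR (2 * eta * kappa))).
  rewrite two; apply: ler_pM => //.
  - by rewrite mulr_ge0 ?expR_ge0// addr_ge0 ?powR_ge0.
  - by rewrite addr_ge0// !mulr_ge0// ltW.
  - by rewrite ler_pM2l ?expR_gt0.
rewrite -!expRD ler_expR.
have -> : - eta * ln 2 + (- (eta * (q * ln q + p * ln p)) + 2 * eta * (eta * K)) +
    2 * eta * kappa = eta * (2 * (eta * K) + 2 * kappa - (g + D)) by rewrite /g; ring.
rewrite -mulrN ler_pM2l//; lra.
Qed.

(** * A placeholder strategy for fewer than four items *)

Section TrivialCode.
Variables (R : realType) (n : nat).

Definition uniform_query (_ : history n) (i j : 'I_n) : R :=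
  (i != j)%:R / (n * n.-1)%:R.

Lemma uniform_query_ge0 h i j : 0 <= uniform_query h i j.
Proof. by rewrite divr_ge0 ?ler0n. Qed.

Lemma uniform_query_diag h i : uniform_query h i i = 0.
Proof. by rewrite /uniform_query eqxx mul0r. Qed.

Lemma uniform_query_sum h : (1 < n)%N -> \sum_i \sum_j uniform_query h i j = 1.
Proof.
move=> n1; rewrite /uniform_query.
have row i : \sum_(j : 'I_n) (i != j)%:R / (n * n.-1)%:R = n%:R^-1 :> R.
  rewrite (bigD1 i)//= eqxx mul0r add0r (eq_bigr (fun=> (n * n.-1)%:R^-1)) => [|j ij].
    rewrite sumr_const cardC1 card_ord natrM invfM -[LHS]mulr_natl mulrCA mulfV ?mulr1//.
    by rewrite pnatr_eq0; case: (n) n1 => [|[]].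
  by rewrite eq_sym ij mul1r.
under eq_bigr do rewrite row.
rewrite sumr_const card_ord -[LHS]mulr_natl mulfV// pnatr_eq0.
by case: (n) n1.
Qed.
End TrivialCode.

(** * The sorting codes and their vanishing error *)

Section Code.
Variables (R : realType) (p Rt eps : R).
Hypotheses (p0 : 0 <= p) (p2 : p < 1 / 2) (Rt0 : 0 < Rt) (eps0 : 0 < eps).

Definition stopping_odds (n : nat) : R := expR ((1 + eps) * ln n%:R).

Definition budget (n : nat) : R := n%:R * log2 n%:R / Rt.

Definition insertion_sort_code (n : nat) : sorting_code R n :=
  match n with
  | n0.+4 => padded_code (@strategy R p (stopping_odds n0.+4) n0) (budget n0.+4)
               (@estimator R p (stopping_odds n0.+4) n0)
  | m => padded_code (@uniform_query R m) (budget m) (fun=> 1%g)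
  end.

Lemma ln_nat_ge0 (n : nat) : 0 <= ln n%:R :> R.
Proof. by case: n => [|n]; [rewrite ln0 | rewrite ln_ge0// ler1n]. Qed.

Lemma ln2_pos : 0 < ln 2 :> R.
Proof. by rewrite ln_gt0// ltr1n. Qed.

Lemma budget_ge0 n : 0 <= budget n.
Proof.
by rewrite divr_ge0 ?(ltW Rt0)// mulr_ge0// divr_ge0 ?ln_nat_ge0 ?(ltW ln2_pos).
Qed.

Lemma budget_neq0 n : budget n != 0 -> (1 < n)%N.
Proof.
by case: n => [|[|n]]//; rewrite /budget /log2 ?ln1 ?mul0r ?mulr0 ?mul0r eqxx.
Qed.

Lemma stopping_odds_ge1 n : 1 <= stopping_odds n.
Proof.
by rewrite -expR0 ler_expR mulr_ge0 ?ln_nat_ge0// addr_ge0// ltW.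
Qed.

Lemma padded_is_code n (Q : history n -> 'I_n -> 'I_n -> R) est :
  (forall h i j, 0 <= Q h i j) -> (forall h i, Q h i i = 0) ->
  ((1 < n)%N -> forall h, \sum_i \sum_j Q h i j = 1) ->
  is_code p Rt (padded_code Q (budget n) est).
Proof.
move=> Q0 Qd Q1; have p1 : p <= 1 by have := p2; lra.
have Q1' : budget n != 0 -> forall h, \sum_i \sum_j Q h i j = 1.
  by move=> /budget_neq0; exact: Q1.
split; first by apply: padded_valid => //; exact: budget_ge0.
move=> pi; split; first by apply: padded_prob_stop => //; exact: budget_ge0.
by apply: padded_expected_M => //; exact: budget_ge0.
Qed.

Lemma padded_error_ge0 n (Q : history n -> 'I_n -> 'I_n -> R) est pi :
  (forall h i j, 0 <= Q h i j) ->
  ((1 < n)%N -> forall h, \sum_i \sum_j Q h i j = 1) ->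
  (0 <= error_prob p pi (padded_code Q (budget n) est))%E.
Proof.
move=> Q0 Q1; have p1 : p <= 1 by have := p2; lra.
rewrite padded_error//; first last.
- by move=> /budget_neq0; exact: Q1.
- exact: budget_ge0.
by rewrite lee_fin sumr_ge0// => h _; rewrite mulr_ge0 ?path_prob_ge0 ?ler0n.
Qed.

Lemma insertion_sort_error_ge0 n (pi : {perm 'I_n}) :
  (0 <= error_prob p pi (insertion_sort_code n))%E.
Proof.
case: n pi => [|[|[|[|n0]]]] pi; apply: padded_error_ge0; try exact: uniform_query_ge0;
  try by move=> ? ?; exact: uniform_query_sum.
- by move=> *; exact: strategy_ge0.
- by move=> _ h; exact: strategy_sum.
Qed.

Lemma insertion_sort_is_code n : is_code p Rt (insertion_sort_code n).
Proof.
case: n => [|[|[|[|n0]]]]; apply: padded_is_code; try exact: uniform_query_ge0;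
  try exact: uniform_query_diag; try by move=> ? ?; exact: uniform_query_sum.
- by move=> *; exact: strategy_ge0.
- by move=> *; exact: strategy_diag (stopping_odds_ge1 _) _ _.
- by move=> _ h; exact: strategy_sum.
Qed.

Variables (eta kappa : R).
Local Notation D := ((2 + 2 * eps) * (ln 2 * Rt)).
Hypotheses (eta01 : 0 < eta < 1) (kappa01 : 0 < kappa <= 1).
Hypothesis drift_le : drift_factor p eta kappa <= expR (- (eta * D)).

Lemma budget_drift n : D * budget n = (2 + 2 * eps) * (n%:R * ln n%:R).
Proof.
by rewrite /budget /log2; field; rewrite !gt_eqF// ln2_pos.
Qed.

Lemma inverse_stopping_odds n : (0 < n)%N ->
  3 * n%:R / stopping_odds n = 3 * expR (- (eps * ln n%:R)).
Proof.
move=> n0; have n0' : 0 < n%:R :> R by rewrite ltr0n.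
rewrite -mulrA; congr (_ * _); rewrite -[n%:R in LHS](lnK n0') -expRN -expRD.
by congr expR; ring.
Qed.

Lemma double_succ_le n : (0 < n)%N -> ((n + n).+1 <= 3 * n)%N.
Proof. by lia. Qed.

(** Over the budget the drift gains [(2 + 2 eps) n ln n] in the exponent, in units of [eta]. The
    factors [c] cost [(2 + eps) n ln n] up to order [n], so a surplus [eps n ln n] remains. *)
Lemma timeout_le n0 (n := n0.+4) (M := (n + n).+1) : 1 <= budget n ->
  drift_factor p eta kappa ^+ (Num.truncn (budget n)).-1 *
    ((M%:R * (stopping_odds n / kappa)) `^ eta) ^+ n <=
  expR (eta * (2 * D - n%:R * (eps * ln n%:R - (ln 3 - ln kappa)))).
Proof.
move=> bud; have [/andP[eta0 eta1] /andP[kappa0 kappa1]] := (eta01, kappa01).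
have dl := drift_le; have e0 := eps0; have R0 := Rt0; have l2 := ln2_pos.
have n_gt0 : 0 < n%:R :> R by rewrite ltr0n.
set N := Num.truncn _.
have /andP[NT TN] := truncn_itv (budget_ge0 n).
have N0 : (0 < N)%N.
  by rewrite -(ltr_nat R) -(ltrD2r 1) add0r natr1 (le_lt_trans bud).
(* One query is lost to rounding and one to drawing the shift. *)
have N1 : budget n - 2 <= N.-1%:R.
  have := TN; rewrite -/N -natr1 -(prednK N0) -natr1; lra.
have D0 : 0 <= D by rewrite !mulr_ge0 ?ltW//; lra.
have M_le : (M%:R : R) <= expR (ln 3 + ln n%:R).
  have three_gt0 : 0 < 3 :> R by [].
  have -> : expR (ln 3 + ln n%:R) = (3 * n)%:R :> R.
    by rewrite expRD (lnK n_gt0) (lnK three_gt0) natrM.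
  by rewrite ler_nat double_succ_le.
have base : M%:R * (stopping_odds n / kappa) <=
    expR (ln 3 + ln n%:R + (1 + eps) * ln n%:R - ln kappa).
  rewrite -addrA expRD [X in _ <= _ * X]expRD expRN (lnK kappa0).
  by rewrite ler_wpM2r// mulr_ge0 ?expR_ge0// invr_ge0 ltW.
have powE (x : R) : expR x `^ eta = expR (eta * x).
  by rewrite /powR gt_eqF ?expR_gt0// expRK.
have base0 : 0 <= M%:R * (stopping_odds n / kappa).
  by rewrite mulr_ge0// divr_ge0 ?expR_ge0 ?ltW.
have c_le := powR_homo (ltW eta0) base0 base.
rewrite powE in c_le.
have rho0 : 0 <= drift_factor p eta kappa by exact: rho_ge0.
apply: (@le_trans _ _ (expR (- (eta * D)) ^+ N.-1 *
   expR (eta * (ln 3 + ln n%:R + (1 + eps) * ln n%:R - ln kappa)) ^+ n)).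
  apply: ler_pM; rewrite ?exprn_ge0 ?powR_ge0//; last first.
    by apply: lerXn2r => //; rewrite nnegrE ?powR_ge0 ?expR_ge0.
  by apply: lerXn2r => //; rewrite nnegrE ?expR_ge0.
rewrite -!expRM_natl -expRD ler_expR.
have : eta * D * (budget n - 2) <= eta * D * N.-1%:R.
  by rewrite ler_wpM2l// mulr_ge0// ltW.
have -> : eta * D * (budget n - 2) = eta * ((2 + 2 * eps) * (n%:R * ln n%:R) - 2 * D).
  by rewrite -budget_drift; ring.
move=> h; rewrite -subr_ge0.
have -> : eta * (2 * D - n%:R * (eps * ln n%:R - (ln 3 - ln kappa))) -
   (N.-1%:R * - (eta * D) +
    n%:R * (eta * (ln 3 + ln n%:R + (1 + eps) * ln n%:R - ln kappa))) =
  eta * D * N.-1%:R - eta * ((2 + 2 * eps) * (n%:R * ln n%:R) - 2 * D) by ring.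
by rewrite subr_ge0.
Qed.

Lemma insertion_sort_error n (pi : {perm 'I_n}) : (4 <= n)%N -> 1 <= budget n ->
  (error_prob p pi (insertion_sort_code n) <=
   (3 * expR (- (eps * ln n%:R)) +
    expR (eta * (2 * D - n%:R * (eps * ln n%:R - (ln 3 - ln kappa)))))%:E)%E.
Proof.
case: n pi => [|[|[|[|n0]]]]// pi _ bud.
have [/andP[eta0 eta1] /andP[kappa0 kappa1]] := (eta01, kappa01).
have p1 : p <= 1 by have := p2; lra.
have A1 := stopping_odds_ge1 n0.+4.
rewrite padded_error//; first last.
- by move=> _ h; exact: strategy_sum.
- exact: budget_ge0.
- by move=> *; exact: strategy_ge0.
have N0 : (0 < Num.truncn (budget n0.+4))%N by rewrite truncn_gt0.
rewrite lee_fin -(prednK N0).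
apply: le_trans (sorting_error pi p0 p2 A1 eta0 eta1 kappa0 kappa1 erefl _) _.
by rewrite inverse_stopping_odds// lerD2l timeout_le.
Qed.

Lemma error_vanishes :
  ((fun n => \big[maxe/0%E]_(pi : {perm 'I_n}) error_prob p pi (insertion_sort_code n))
    @ \oo --> 0%E)%classic.
Proof.
have [/andP[eta0 eta1] /andP[kappa0 kappa1]] := (eta01, kappa01).
have e0 := eps0; have R0 := Rt0.
set f := fun n : nat => _.
have f_ge0 n : (0 <= f n)%E.
  rewrite /f; elim/big_ind : _ => // [x y x0 y0|pi _]; first by rewrite le_max x0.
  exact: insertion_sort_error_ge0.
suff small (e : R) : 0 < e -> \forall n \near \oo%classic, (f n <= e%:E)%E.
  have fin e n : (f n <= e%:E)%E -> f n \is a fin_num.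
    by move=> fe; rewrite ge0_fin_numE// (le_lt_trans fe) ?ltry.
  apply: cvg_EFin.
    by apply: filterS (small 1 ltr01) => n; exact: fin.
  apply/cvgrPdist_le => e e_gt0.
  apply: filterS (small e e_gt0) => n fe.
  rewrite sub0r normrN ger0_norm ?fine_ge0//= -lee_fin fineK//; exact: fin fe.
have le_ln (x : R) (n : nat) : expR x <= n%:R -> x <= ln n%:R.
  move=> xn; rewrite -[leLHS]expRK ler_ln ?posrE ?expR_gt0//.
  exact: lt_le_trans (expR_gt0 _) xn.
move=> e_gt0.
have e2 : 0 < e / 2 by rewrite divr_gt0.
have e6 : 0 < 6 / e by rewrite divr_gt0.
near=> n.
have n4 : (4 <= n)%N by near: n; exact: nbhs_infty_ge.
have ln_ge1 : 1 <= ln n%:R :> R by apply: le_ln; near: n; exact: nbhs_infty_ger.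
have n_Rt : ln 2 * Rt <= n%:R by near: n; exact: nbhs_infty_ger.
have ln_wrong : ln (6 / e) / eps <= ln n%:R.
  by apply: le_ln; near: n; exact: nbhs_infty_ger.
(* This makes the timeout exponent at most [eta * (2 * D - n)], which the next condition brings
   below [ln (e / 2)]. *)
have ln_timeout : (1 + (ln 3 - ln kappa)) / eps <= ln n%:R.
  by apply: le_ln; near: n; exact: nbhs_infty_ger.
have n_timeout : (eta * (2 * D) - ln (e / 2)) / eta <= n%:R.
  by near: n; exact: nbhs_infty_ger.
have bud : 1 <= budget n.
  have -> : budget n = n%:R * ln n%:R / (ln 2 * Rt).
    by rewrite /budget /log2; field; rewrite !gt_eqF// ln2_pos.
  rewrite ler_pdivlMr ?mulr_gt0 ?ln2_pos// mul1r (le_trans n_Rt)//.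
  by rewrite ler_peMr.
apply: bigmax_le => [|pi _]; first by rewrite lee_fin ltW.
apply: le_trans (insertion_sort_error pi n4 bud) _.
rewrite lee_fin [e in leRHS]splitr; apply: lerD.
  have -> : e / 2 = 3 * expR (- ln (6 / e)).
    by rewrite expRN lnK//; field; rewrite gt_eqF.
  rewrite ler_pM2l// ler_expR lerN2.
  by move: ln_wrong; rewrite ler_pdivrMr// [leRHS]mulrC.
rewrite -[leRHS](lnK e2) ler_expR.
move: n_timeout ln_timeout; rewrite !ler_pdivrMr// => n_timeout ln_timeout.
have : n%:R * 1 <= n%:R * (eps * ln n%:R - (ln 3 - ln kappa)).
  by rewrite ler_wpM2l//; lra.
rewrite mulr1 -(ler_pM2l eta0) => h; rewrite mulrBr; lra.
Unshelve. all: by end_near.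
Qed.
End Code.

Theorem theorem1 (R : realType) (p Rt : R) :
  0 <= p -> p < 1 / 2 ->
  0 < Rt -> Rt < (1 - binary_entropy p) / 2 ->
  achievable p Rt.
Proof.
move=> p0 p2 Rt0 Rt_lt.
have l2 : 0 < ln 2 :> R by exact: ln2_pos.
have entE : ln 2 * (1 - binary_entropy p) = ln 2 + p * ln p + (1 - p) * ln (1 - p).
  have xlog2E x : xlog2 x = x * ln x / ln 2 :> R.
    by rewrite /xlog2 /log2; case: eqP => [->|_]; rewrite ?mul0r// mulrA.
  by rewrite /binary_entropy !xlog2E; field; rewrite gt_eqF.
(* The choice gives [(2 + 4 eps) Rt = 1 - H(p)]; the drift is asked to reach only [2 + 2 eps], which
   leaves strict slack. *)
pose eps := ((1 - binary_entropy p) / Rt - 2) / 4.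
have epsE : (2 + 4 * eps) * Rt = 1 - binary_entropy p.
  by rewrite /eps; field; rewrite gt_eqF.
have eps0 : 0 < eps.
  by rewrite divr_gt0// subr_gt0 ltr_pdivlMr//; lra.
have hD : (2 + 2 * eps) * (ln 2 * Rt) < ln 2 + p * ln p + (1 - p) * ln (1 - p).
  rewrite -entE -epsE mulrCA ltr_pM2l// ltr_pM2r//; lra.
have [eta [kappa [eta01 kappa01 drift_le]]] := drift_factor_le p0 p2 hD.
exists (insertion_sort_code p Rt eps); split.
  by move=> n; exact: insertion_sort_is_code.
exact: error_vanishes eta01 kappa01 drift_le.
Qed.
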